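(* For every integer $k\ge 17$, $\mathrm{gap}(\mathrm{cs}_k^{\mathbb{O}})>2$, and $$\mathrm{cs}_k^{\mathbb{O}}(x,y)+\tfrac14\left(\|x\|^2+\|y\|^2\right)^2$$ is a convex quartic form in $16k$ (real) variables that is not a sum of squares.
   Context: $\mathbb{O}$ denotes the octonions: the $8$-dimensional real normed division algebra with basis $e_0=1,e_1,\ldots,e_7$. For $u=\sum_{i=0}^7 a_ie_i$, the conjugate is $\overline{u}=a_0e_0-\sum_{i=1}^7 a_ie_i$ and the norm is $|u|=(\overline{u}u)^{1/2}=(\sum_{i=0}^7a_i^2)^{1/2}$. For $x,y\in\mathbb{O}^k$, put $\|x\|^2=\sum_{i=1}^k|x_i|^2$ and $(x,y)=\sum_{i=1}^k\overline{x_i}y_i\in\mathbb{O}$. The octonionic Cauchy–Schwarz form is $$\mathrm{cs}_k^{\mathbb{O}}(x,y)=\|x\|^2\|y\|^2-|(x,y)|^2,\qquad (x,y)\in\mathbb{O}^k\times\mathbb{O}^k\cong\mathbb{R}^{16k},$$ a quartic form in the $16k$ real coordinates of $(x,y)$. A form is a homogeneous real polynomial; a form is a sum of squares if it is a finite sum of squares of real polynomials; a form is convex if it is a convex function. For a form $p$ of degree $2d$ in $n$ variables that is not constant on the unit sphere, $p_{\min}$ and $p_{\max}$ are its minimum and maximum on the Euclidean unit sphere of $\mathbb{R}^n$, $p_{\min}^{\mathrm{sos}}=\max\{\gamma\in\mathbb{R}: p(z)-\gamma\|z\|^{2d}\text{ is a sum of squares}\}$, and $\mathrm{gap}(p)=\dfrac{p_{\max}-p_{\min}^{\mathrm{sos}}}{p_{\max}-p_{\min}}$.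 *)

(* Defs.v *)
From HB Require Import structures.
From mathcomp Require Import all_boot all_order all_algebra.
From mathcomp Require Import mpoly ring.
From mathcomp Require Import boolp classical_sets reals convex.

Set Implicit Arguments.
Unset Strict Implicit.
Unset Printing Implicit Defensive.

Import Order.TTheory GRing.Theory Num.Theory.

Local Open Scope ring_scope.

(* Octonions are row vectors of coordinates in the basis e_0 = 1, ..., e_7.
   The coefficients may lie in any commutative ring, so that the same formulas
   give both functions on O^k (coefficients in R) and polynomials in the real
   coordinates (coefficients in {mpoly R[n]}). *)

(* The triples (i, j, l) for which e_i e_j = e_l, up to cyclic rotation:
   e_s e_(s+1) = e_(s+3), with indices 1..7 read modulo 7. *)
Definition oct_lines : seq (nat * nat * nat) :=
  [:: (1, 2, 4); (2, 3, 5); (3, 4, 6); (4, 5, 7); (5, 6, 1); (6, 7, 2);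
      (7, 1, 3)]%N.

Definition oct_oriented (i j l : nat) : bool :=
  [|| (i, j, l) \in oct_lines, (j, l, i) \in oct_lines
    | (l, i, j) \in oct_lines].

(* e_i e_j = \sum_l oct_coef i j l e_l *)
Definition oct_coef (i j l : nat) : int :=
  if i == 0%N then (j == l)%:R
  else if j == 0%N then (i == l)%:R
  else if i == j then - (l == 0%N)%:R
  else (oct_oriented i j l)%:R - (oct_oriented j i l)%:R.

Definition omul (A : comNzRingType) (u v : 'rV[A]_8) : 'rV[A]_8 :=
  \row_(l < 8) \sum_(i < 8) \sum_(j < 8) (u 0 i * v 0 j) *~ oct_coef i j l.

Definition oconj (A : comNzRingType) (u : 'rV[A]_8) : 'rV[A]_8 :=
  \row_(i < 8) (if i == 0 then u 0 i else - u 0 i).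

(* |u|^2 *)
Definition onormsq (A : comNzRingType) (u : 'rV[A]_8) : A :=
  \sum_(i < 8) u 0 i ^+ 2.

Lemma omul1o (A : comNzRingType) (u : 'rV[A]_8) : omul (delta_mx 0 0) u = u.
Proof.
apply/rowP => l; rewrite !mxE (bigD1 ord0) //= (bigD1 l) //= big1 => [|j jl].
  rewrite addr0 big1 => [|i i0].
    by rewrite addr0 mxE !eqxx /= mul1r /oct_coef /= eqxx mulr1z.
  by apply: big1 => j _; rewrite mxE (negbTE i0) andbF mul0r mul0rz.
have jlN : (val j == val l) = false by apply/negbTE.
by rewrite mxE !eqxx /= mul1r /oct_coef /= jlN mulr0z.
Qed.

Lemma sum_ord8 (A : comNzRingType) (F : 'I_8 -> A) :
  \sum_(i < 8) F i = F 0 + F 1 + F 2 + F 3 + F 4 + F 5 + F 6 + F 7.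
Proof.
rewrite !big_ord_recl big_ord0 addr0 !addrA.
by do ?congr (_ + _); congr F; apply: val_inj.
Qed.

Lemma omulE (A : comNzRingType) (u v : 'rV[A]_8) (l : 'I_8) :
  omul u v 0 l = nth 0 [::
    u 0 0 * v 0 0 - u 0 1 * v 0 1 - u 0 2 * v 0 2 - u 0 3 * v 0 3
    - u 0 4 * v 0 4 - u 0 5 * v 0 5 - u 0 6 * v 0 6 - u 0 7 * v 0 7;
    u 0 0 * v 0 1 + u 0 1 * v 0 0 + (u 0 2 * v 0 4 - u 0 4 * v 0 2)
    + (u 0 3 * v 0 7 - u 0 7 * v 0 3) + (u 0 5 * v 0 6 - u 0 6 * v 0 5);
    u 0 0 * v 0 2 + u 0 2 * v 0 0 + (u 0 3 * v 0 5 - u 0 5 * v 0 3)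
    + (u 0 4 * v 0 1 - u 0 1 * v 0 4) + (u 0 6 * v 0 7 - u 0 7 * v 0 6);
    u 0 0 * v 0 3 + u 0 3 * v 0 0 + (u 0 4 * v 0 6 - u 0 6 * v 0 4)
    + (u 0 5 * v 0 2 - u 0 2 * v 0 5) + (u 0 7 * v 0 1 - u 0 1 * v 0 7);
    u 0 0 * v 0 4 + u 0 4 * v 0 0 + (u 0 1 * v 0 2 - u 0 2 * v 0 1)
    + (u 0 5 * v 0 7 - u 0 7 * v 0 5) + (u 0 6 * v 0 3 - u 0 3 * v 0 6);
    u 0 0 * v 0 5 + u 0 5 * v 0 0 + (u 0 2 * v 0 3 - u 0 3 * v 0 2)
    + (u 0 6 * v 0 1 - u 0 1 * v 0 6) + (u 0 7 * v 0 4 - u 0 4 * v 0 7);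
    u 0 0 * v 0 6 + u 0 6 * v 0 0 + (u 0 1 * v 0 5 - u 0 5 * v 0 1)
    + (u 0 3 * v 0 4 - u 0 4 * v 0 3) + (u 0 7 * v 0 2 - u 0 2 * v 0 7);
    u 0 0 * v 0 7 + u 0 7 * v 0 0 + (u 0 1 * v 0 3 - u 0 3 * v 0 1)
    + (u 0 2 * v 0 6 - u 0 6 * v 0 2) + (u 0 4 * v 0 5 - u 0 5 * v 0 4)] l.
Proof.
pose sg (c : int) (t : A) := match c with
  | Posz 0 => 0 | Posz 1 => t | Negz 0 => - t | _ => t *~ c end.
have sgE c t : t *~ c = sg c t by case: c => [[|[|c]]|[|c]].
have expand (F : 'I_8 -> 'I_8 -> A) :
    \sum_(i < 8) \sum_(j < 8) F i j =
    \sum_(i < 8) (F i 0 + F i 1 + F i 2 + F i 3 + F i 4 + F i 5 + F i 6 + F i 7).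
  by apply: eq_bigr => i _; rewrite sum_ord8.
rewrite mxE expand sum_ord8.
move: (u 0) (v 0) => {u v}a b; rewrite !sgE.
case: l; do 8?[case=> [l8|//]];
  repeat match goal with |- context [sg (oct_coef ?i ?j ?l) ?t] =>
    let c := eval vm_compute in (oct_coef i j l) in
    change (sg (oct_coef i j l) t) with (sg c t) end;
  rewrite /sg /=; ring.
Qed.

Lemma omul_conj (A : comNzRingType) (u : 'rV[A]_8) :
  omul (oconj u) u = \row_(l < 8) (if l == 0 then onormsq u else 0).
Proof.
apply/rowP => l; rewrite omulE !mxE /onormsq sum_ord8.
by case: l; do 8?[case=> [l8 /=|//]]; ring.
Qed.

Lemma onormsqM (A : comNzRingType) (u v : 'rV[A]_8) :
  onormsq (omul u v) = onormsq u * onormsq v.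
Proof. by rewrite /onormsq !sum_ord8 !omulE /=; ring. Qed.

(* Vectors of O^k are k x 8 matrices, whose rows are the k octonions. *)

Definition ovnormsq (A : comNzRingType) (k : nat) (x : 'M[A]_(k, 8)) : A :=
  \sum_(i < k) onormsq (row i x).

Definition ovdot (A : comNzRingType) (k : nat) (x y : 'M[A]_(k, 8)) :
    'rV[A]_8 :=
  \sum_(i < k) omul (oconj (row i x)) (row i y).

Definition cs_oct (A : comNzRingType) (k : nat) (x y : 'M[A]_(k, 8)) : A :=
  ovnormsq x * ovnormsq y - onormsq (ovdot x y).

Lemma dim_oct_pair (k : nat) : (k * 8 + k * 8 = 16 * k)%N.
Proof. by rewrite -mulnDr mulnC. Qed.

(* The 16k real coordinates of (x, y): first those of x_1, ..., x_k, then those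
   of y_1, ..., y_k. *)
Definition xcoord (k : nat) (i : 'I_k) (a : 'I_8) : 'I_(16 * k) :=
  cast_ord (dim_oct_pair k) (lshift (k * 8) (mxvec_index i a)).

Definition ycoord (k : nat) (i : 'I_k) (a : 'I_8) : 'I_(16 * k) :=
  cast_ord (dim_oct_pair k) (rshift (k * 8) (mxvec_index i a)).

Definition xvars (R : realType) (k : nat) : 'M[{mpoly R[16 * k]}]_(k, 8) :=
  \matrix_(i < k, a < 8) 'X_(xcoord i a).

Definition yvars (R : realType) (k : nat) : 'M[{mpoly R[16 * k]}]_(k, 8) :=
  \matrix_(i < k, a < 8) 'X_(ycoord i a).

Definition csO (R : realType) (k : nat) : {mpoly R[16 * k]} :=
  cs_oct (xvars R k) (yvars R k).

Definition peval (R : realType) (n : nat) (p : {mpoly R[n]}) (z : 'rV[R]_n) :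
    R :=
  p.@[fun i => z 0 i].

Lemma peval_csO (R : realType) (k : nat) (z : 'rV[R]_(16 * k)) :
  peval (csO R k) z =
  cs_oct (\matrix_(i < k, a < 8) z 0 (xcoord i a))
         (\matrix_(i < k, a < 8) z 0 (ycoord i a)).
Proof.
pose ev (i : 'I_(16 * k)) := z 0 i.
have onE m (u : 'rV[{mpoly R[m]}]_8) w :
    (onormsq u).@[w] = onormsq (map_mx (meval w) u).
  by rewrite raddf_sum; apply: eq_bigr => i _; rewrite /= rmorphXn /= mxE.
have nE m (x : 'M[{mpoly R[m]}]_(k, 8)) w :
    (ovnormsq x).@[w] = ovnormsq (map_mx (meval w) x).
  rewrite raddf_sum; apply: eq_bigr => i _; rewrite /= onE; congr onormsq.
  by apply/rowP => a; rewrite !mxE.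
have dE m (x y : 'M[{mpoly R[m]}]_(k, 8)) w :
    map_mx (meval w) (ovdot x y) =
    ovdot (map_mx (meval w) x) (map_mx (meval w) y).
  apply/rowP => l; rewrite mxE !summxE raddf_sum; apply: eq_bigr => i _.
  rewrite !mxE raddf_sum; apply: eq_bigr => a _.
  rewrite raddf_sum; apply: eq_bigr => b _.
  rewrite /= raddfMz /= mevalM !mxE; congr (_ * _ *~ _).
  by case: ifP => _; rewrite ?mevalN.
rewrite /peval /csO /cs_oct mevalB mevalM !nE onE dE.
have -> : map_mx (meval ev) (xvars R k) = \matrix_(i, a) z 0 (xcoord i a).
  by apply/matrixP => i a; rewrite !mxE mevalXU.
have -> // : map_mx (meval ev) (yvars R k) = \matrix_(i, a) z 0 (ycoord i a).
by apply/matrixP => i a; rewrite !mxE mevalXU.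
Qed.

Definition is_sos (R : realType) (n : nat) (p : {mpoly R[n]}) : Prop :=
  exists s : seq {mpoly R[n]}, p = \sum_(q <- s) q ^+ 2.

Definition convex_poly (R : realType) (n : nat) (p : {mpoly R[n]}) : Prop :=
  convex_function [set: 'rV[R]_n] (peval p).

Definition normsq_poly (R : realType) (n : nat) : {mpoly R[n]} :=
  \sum_(i < n) 'X_i ^+ 2.

(* The Euclidean unit sphere; the library norm on 'rV[R]_n is the sup norm. *)
Definition unit_sphere (R : realType) (n : nat) : set 'rV[R]_n :=
  [set z | \sum_(i < n) z 0 i ^+ 2 = 1].

(* Attained maximum and minimum of a set of reals, with value 0 by convention
   when they are not attained. *)
Definition set_max (R : realType) (S : set R) : R :=
  xget 0 [set m | S m /\ forall a, S a -> a <= m].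

Definition set_min (R : realType) (S : set R) : R :=
  xget 0 [set m | S m /\ forall a, S a -> m <= a].

Definition pmax (R : realType) (n : nat) (p : {mpoly R[n]}) : R :=
  set_max [set peval p z | z in @unit_sphere R n].

Definition pmin (R : realType) (n : nat) (p : {mpoly R[n]}) : R :=
  set_min [set peval p z | z in @unit_sphere R n].

Definition pmin_sos (R : realType) (n d : nat) (p : {mpoly R[n]}) : R :=
  set_max [set gamma | is_sos (p - gamma *: normsq_poly R n ^+ d)].

(* For a form p of degree 2d that is not constant on the unit sphere. *)
Definition gap (R : realType) (n d : nat) (p : {mpoly R[n]}) : R :=
  (pmax p - pmin_sos d p) / (pmax p - pmin p).

(* Main.v *)
(** For z = (x, y) in O^2 = R^16 let q(z) = (|x|^2 - |y|^2, 2 conj(x) y) in R^9.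
    Its coordinates are z^T S_a z for nine anticommuting symmetric orthogonal
    matrices S_0, ..., S_8 (a Clifford system), and with Q = \sum_i q(z_i),
    4 cs = |z|^4 - |Q|^2.  Everything follows from one Fierz identity for
    \sum_a S_a (x) S_a in terms of the S_a and the products S_a S_b (a < b).

    Sum of squares: for c = 15k/(7k+8), the form c |z|^4 - |Q|^2 is a
    combination of the squares of z_i^T S_a z_j - delta_ij (mean of the
    z_i^T S_a z_i) and of the entries of the projection of z_i /\ z_j onto the
    complement of the span of the S_a S_b.  Optimality: a fourth order constant
    coefficient operator, invariant under O(k) x Spin(9), is nonnegative at 0 on
    all squares of quadratic forms and vanishes on this extremal form.  Hence
    gap = c, which exceeds 2 iff k > 16.

    Convexity of 2 |z|^4 - |Q|^2: average |Q| <= |.|^2 at z + w and z - w, for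
    |z| = |w|. *)

Require Import Defs.
From HB Require Import structures.
From mathcomp Require Import all_boot all_order all_algebra.
From mathcomp Require Import mpoly ring lra.
From mathcomp Require Import boolp classical_sets reals convex interval_inference.

Set Implicit Arguments.
Unset Strict Implicit.
Unset Printing Implicit Defensive.

Import Order.TTheory GRing.Theory Num.Theory.

Local Open Scope ring_scope.

(** * The Clifford system on R^16 and its integer identities, checked by computation *)

(* Entries of S_a.  The coordinates 0..7 of R^16 are those of x and 8..15 those
   of y; S_0, ..., S_7 give the coordinates of 2 conj(x) y, and S_8 gives
   |x|^2 - |y|^2. *)
Definition clif (a p q : nat) : int :=
  let c l i j := (if i == 0%N then oct_coef i j l else - oct_coef i j l) in
  if a == 8 then (if p == q then (if (p < 8)%N then 1 else -1) else 0)
  else if (p < 8)%N then (if (q < 8)%N then 0 else c a p (q - 8)%N)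
  else if (q < 8)%N then c a q (p - 8)%N else 0.

Definition pairs9 : seq (nat * nat) :=
  [seq ab <- [seq (a, b) | a <- iota 0 9, b <- iota 0 9] | (ab.1 < ab.2)%N].

Definition tabulate (m : nat) (F : nat -> nat -> nat -> int) :=
  [seq [seq [seq F a p q | a <- iota 0 m] | q <- iota 0 16] | p <- iota 0 16].

Definition clif_tab := Eval vm_compute in tabulate 9 clif.
(* Entry (p, q) lists the (p, q) entries of the 36 products S_a S_b, a < b. *)
Definition clif2_tab := Eval vm_compute in tabulate 36 (fun c p q =>
  let ab := nth (0, 0)%N pairs9 c in
  foldr (fun r t => clif ab.1 p r * clif ab.2 r q + t) 0 (iota 0 16)).

Definition cell (t : seq (seq (seq int))) p q := nth [::] (nth [::] t p) q.

Definition clif2 (c p q : nat) : int := nth 0 (cell clif2_tab p q) c.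

Lemma clif_tabE : clif_tab = tabulate 9 clif. Proof. by vm_compute. Qed.
Lemma clif2_tabE : clif2_tab = tabulate 36 clif2. Proof. by vm_compute. Qed.

(* Dot product that skips the zeros of these sparse vectors: the identity below
   is checked on 16^4 index tuples. *)
Fixpoint dotz (u v : seq int) : int :=
  match u, v with
  | x :: u', y :: v' => match x, y with
     | Posz 0, _ | _, Posz 0 => dotz u' v'
     | _, _ => intZmod.addz (intRing.mulz x y) (dotz u' v') end
  | _, _ => 0
  end.

(** The Fierz rearrangement: the tensor \sum_a S_a (x) S_a, read with its index pairs regrouped,
    expands in the S_a, the products S_a S_b and the identity. It is doubled so that all
    coefficients are integers. *)
Definition fierz_check : bool :=
  let S := clif_tab in let W := clif2_tab in
  let I := iota 0 16 in
  let d (p q : nat) : int := (p == q)%:R in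
  all (fun p => all (fun q => let Spq := cell S p q in let Wpq := cell W p q in
  all (fun r => let Spr := cell S p r in all (fun u =>
    dotz Spr (cell S q u) *+ 2 ==
     d p q * d r u - dotz Spq (cell S r u) + dotz Wpq (cell W r u)
     - (d p r * d q u) *+ 2 + (d p u * d q r) *+ 4) I) I) I) I.
Lemma fierz_checkT : fierz_check. Proof. by vm_compute. Qed.

Lemma mem_iota0 (n : nat) (i : 'I_n) : val i \in iota 0 n.
Proof. by rewrite mem_iota ltn_ord. Qed.

Lemma cell_tabulate m F (p q : 'I_16) :
  cell (tabulate m F) p q = [seq F a p q | a <- iota 0 m].
Proof.
rewrite /cell /tabulate (nth_map 0%N) ?size_iota// nth_iota// add0n.
by rewrite (nth_map 0%N) ?size_iota// nth_iota// add0n.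
Qed.

Lemma dotzE m (F G : nat -> int) :
  dotz [seq F a | a <- iota 0 m] [seq G a | a <- iota 0 m] =
  \sum_(a < m) F a * G a.
Proof.
rewrite -(big_mkord predT (fun a => F a * G a)) /index_iota subn0.
elim: (iota 0 m) => [|a s IH]; first by rewrite big_nil.
rewrite big_cons -IH /=.
have E : F a * G a + dotz (map F s) (map G s) =
  intZmod.addz (intRing.mulz (F a) (G a)) (dotz (map F s) (map G s)) by [].
by case: (F a) E => [[|?]|?] E; case: (G a) E => [[|?]|?] E //;
  rewrite ?mul0r ?mulr0 ?add0r.
Qed.

Lemma clif_fierz_int (p q r u : 'I_16) :
  (\sum_(a < 9) clif a p r * clif a q u) *+ 2 =
  (p == q)%:R * (r == u)%:R - \sum_(a < 9) clif a p q * clif a r u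
  + \sum_(c < 36) clif2 c p q * clif2 c r u
  - ((p == r)%:R * (q == u)%:R) *+ 2 + ((p == u)%:R * (q == r)%:R) *+ 4.
Proof.
have /allP/(_ _ (mem_iota0 p))/allP/(_ _ (mem_iota0 q)) := fierz_checkT.
move=> /allP/(_ _ (mem_iota0 r))/allP/(_ _ (mem_iota0 u))/eqP.
by rewrite clif_tabE clif2_tabE !cell_tabulate !dotzE.
Qed.

Definition symm_check : bool :=
  let I := iota 0 16 in
  all (fun p => all (fun q => (cell clif_tab p q == cell clif_tab q p) &&
    (cell clif2_tab p q == map intZmod.oppz (cell clif2_tab q p))) I) I.

Lemma symm_checkT : symm_check. Proof. by vm_compute. Qed.

Lemma clif_sym (a : 'I_9) (p q : 'I_16) : clif a p q = clif a q p.
Proof.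
have /allP/(_ _ (mem_iota0 p))/allP/(_ _ (mem_iota0 q))/andP[] := symm_checkT.
rewrite clif_tabE !cell_tabulate => /eqP/(congr1 (fun s => nth 0 s a)) + _.
by rewrite !(nth_map 0%N) ?size_iota// nth_iota.
Qed.

(** For a < b the transpose of S_a S_b is S_b S_a = - S_a S_b. *)
Lemma clif2_anti (c : 'I_36) (p q : 'I_16) : clif2 c p q = - clif2 c q p.
Proof.
have /allP/(_ _ (mem_iota0 p))/allP/(_ _ (mem_iota0 q))/andP[] := symm_checkT.
rewrite clif2_tabE !cell_tabulate => _ /eqP/(congr1 (fun s => nth 0 s c)).
by rewrite -map_comp !(nth_map 0%N) ?size_iota// nth_iota.
Qed.

Definition flat16 (F : nat -> nat -> int) : seq int :=
  [seq F p q | p <- iota 0 16, q <- iota 0 16].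

Definition clif_rows := Eval vm_compute in map (flat16 \o clif) (iota 0 9).
Definition clif2_rows := Eval vm_compute in map (flat16 \o clif2) (iota 0 36).

Lemma clif_rowsE : clif_rows = map (flat16 \o clif) (iota 0 9).
Proof. by vm_compute. Qed.
Lemma clif2_rowsE : clif2_rows = map (flat16 \o clif2) (iota 0 36).
Proof. by vm_compute. Qed.

(** Orthogonality for the trace form, with matrices flattened to vectors of length 256. The squared
    norm 16 is the trace of the identity, as the S_a and S_a S_b are orthogonal matrices. *)
Definition ortho_check m (rows : seq (seq int)) : bool :=
  all (fun c => all (fun c' =>
    dotz (nth [::] rows c) (nth [::] rows c') == (c == c')%:R *+ 16)
    (iota 0 m)) (iota 0 m).

Lemma clif_ortho_check : ortho_check 9 clif_rows. Proof. by vm_compute. Qed.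
Lemma clif2_ortho_check : ortho_check 36 clif2_rows. Proof. by vm_compute. Qed.

Lemma dotz_cat u v u' v' : size u = size v ->
  dotz (u ++ u') (v ++ v') = dotz u v + dotz u' v'.
Proof.
elim: u v => [|x u IH] [|y v] //=; first by rewrite add0r.
move=> [/IH E]; case: x => [[|?]|?]; case: y => [[|?]|?] //;
  by rewrite E; exact: addrA.
Qed.

Lemma dotz_flat (F G : nat -> nat -> int) :
  dotz (flat16 F) (flat16 G) = \sum_(p < 16) \sum_(q < 16) F p q * G p q.
Proof.
rewrite -(big_mkord predT (fun p => \sum_(q < 16) F p q * G p q)).
rewrite /index_iota subn0.
have flatE H : flat16 H = flatten [seq [seq H p q | q <- iota 0 16] | p <- iota 0 16].
  by [].
rewrite !flatE; under eq_bigr do rewrite -dotzE.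
(* The list of row indices is generalized apart from that of column indices, so that the induction
   removes one whole row at a time. *)
move: {2 4 5}(iota 0 16) => J; move: (iota 0 16) => I; elim: J => [|p s IH] /=.
  by rewrite big_nil.
by rewrite big_cons -IH dotz_cat ?size_map.
Qed.

Lemma ortho_checkP m F (c c' : 'I_m) :
  ortho_check m (map (flat16 \o F) (iota 0 m)) ->
  \sum_(p < 16) \sum_(q < 16) F c p q * F c' p q = (c == c')%:R *+ 16.
Proof.
move=> /allP/(_ _ (mem_iota0 c))/allP/(_ _ (mem_iota0 c'))/eqP.
by rewrite !(nth_map 0%N) ?size_iota ?ltn_ord // !nth_iota ?ltn_ord // -dotz_flat.
Qed.

Lemma clif_ortho (a b : 'I_9) :
  \sum_(p < 16) \sum_(q < 16) clif a p q * clif b p q = (a == b)%:R *+ 16.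
Proof. by apply: ortho_checkP; rewrite -clif_rowsE clif_ortho_check. Qed.

Lemma clif2_ortho (c c' : 'I_36) :
  \sum_(p < 16) \sum_(q < 16) clif2 c p q * clif2 c' p q = (c == c')%:R *+ 16.
Proof. by apply: ortho_checkP; rewrite -clif2_rowsE clif2_ortho_check. Qed.

Notation pr16 := ('I_16 * 'I_16)%type.

(** * The Fierz identity contracted with two matrices, over any commutative ring *)

Section Fierz.
Context (A : comNzRingType).
Implicit Types (M N : 'I_16 -> 'I_16 -> A).

Definition clifR (a : 'I_9) (p q : 'I_16) : A := (clif a p q)%:~R.
Definition clif2R (c : 'I_36) (p q : 'I_16) : A := (clif2 c p q)%:~R.

Definition frob M N : A := \sum_(i : pr16) M i.1 i.2 * N i.1 i.2.

Definition mtrace M : A := \sum_p M p p.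

(** The Frobenius pairing of [M] with \sum_a S_a N S_a, since the S_a are symmetric. *)
Definition sandwich M N : A := \sum_(a < 9) \sum_(i : pr16) \sum_(j : pr16)
  clifR a i.1 j.1 * clifR a i.2 j.2 * (M i.1 i.2 * N j.1 j.2).

Lemma clif_fierz (p q r u : 'I_16) :
  (\sum_a clifR a p r * clifR a q u) *+ 2 =
  (p == q)%:R * (r == u)%:R - \sum_a clifR a p q * clifR a r u
  + \sum_c clif2R c p q * clif2R c r u
  - ((p == r)%:R * (q == u)%:R) *+ 2 + ((p == u)%:R * (q == r)%:R) *+ 4.
Proof.
have := congr1 (fun t : int => t%:~R : A) (clif_fierz_int p q r u).
rewrite /clifR /clif2R !(rmorphMn, rmorphD, rmorphN, rmorph_sum, rmorphM) /=.
by do !under [\sum_(i < _) (_ * _)%:~R]eq_bigr do rewrite rmorphM /=.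
Qed.

Lemma mtraceE M : mtrace M = \sum_(i : pr16) (i.1 == i.2)%:R * M i.1 i.2.
Proof.
rewrite -(pair_bigA _ (fun p q : 'I_16 => (p == q)%:R * M p q)) /=.
apply: eq_bigr => p _; rewrite (bigD1 p) //= eqxx mul1r big1 ?addr0 // => q.
by rewrite eq_sym => /negbTE ->; rewrite mul0r.
Qed.

(** This is [clif_fierz] weighted by M p q * N r u and summed; the last two terms pair [M] with [N]
    and with its transpose. *)
Lemma sandwichE M N : sandwich M N *+ 2 =
  mtrace M * mtrace N - \sum_a frob (clifR a) M * frob (clifR a) N
  + \sum_c frob (clif2R c) M * frob (clif2R c) N
  - frob M N *+ 2 + frob M (fun p q => N q p) *+ 4.
Proof.
pose X (i j : pr16) := M i.1 i.2 * N j.1 j.2.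
have -> : sandwich M N *+ 2 = \sum_i \sum_j
    (\sum_a clifR a i.1 j.1 * clifR a i.2 j.2) *+ 2 * X i j.
  rewrite /sandwich exchange_big -sumrMnl; apply: eq_bigr => i _ /=.
  rewrite exchange_big -sumrMnl; apply: eq_bigr => j _ /=.
  by rewrite mulrnAl mulr_suml.
have prodE (F G : pr16 -> A) : (\sum_i F i * M i.1 i.2) * (\sum_j G j * N j.1 j.2) =
    \sum_i \sum_j F i * G j * X i j.
  rewrite big_distrlr; apply: eq_bigr => i _; apply: eq_bigr => j _.
  by rewrite /X mulrACA.
have sumprodE (I : finType) (F G : I -> 'I_16 -> 'I_16 -> A) :
    \sum_a frob (F a) M * frob (G a) N =
    \sum_i \sum_j (\sum_a F a i.1 i.2 * G a j.1 j.2) * X i j.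
  under eq_bigr do rewrite /frob (prodE (fun i => F _ i.1 i.2) (fun i => G _ i.1 i.2)).
  rewrite exchange_big; apply: eq_bigr => i _.
  by rewrite exchange_big; apply: eq_bigr => j _; rewrite mulr_suml.
have E1 : frob M N = \sum_i \sum_(j : pr16)
    (i.1 == j.1)%:R * (i.2 == j.2)%:R * X i j.
  apply: eq_bigr => i _; rewrite (bigD1 i) //= !eqxx !mul1r big1 ?addr0 //.
  move=> j ji; rewrite -natrM mulnb -xpair_eqE -!surjective_pairing eq_sym.
  by rewrite (negbTE ji) mul0r.
have E2 : frob M (fun p q => N q p) = \sum_i \sum_(j : pr16)
    (i.1 == j.2)%:R * (i.2 == j.1)%:R * X i j.
  apply: eq_bigr => i _; rewrite (bigD1 (i.2, i.1)) //= !eqxx !mul1r big1 ?addr0 //.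
  move=> [j1 j2] ji; rewrite -natrM mulnb /= (eq_sym i.1) (eq_sym i.2) andbC.
  by rewrite -xpair_eqE (negbTE ji) mul0r.
rewrite !mtraceE prodE !sumprodE E1 E2 -!sumrMnl -!sumrN -!big_split /=.
apply: eq_bigr => i _; rewrite -!sumrMnl -!sumrN -!big_split /=.
by apply: eq_bigr => j _; rewrite clif_fierz; ring.
Qed.

End Fierz.

(** * Bilinear forms z^T S_a w and z^T S_a S_b w, and projections onto orthogonal families *)

Section Bilinear.
Context (A : comNzRingType).
Implicit Types (M N : 'I_16 -> 'I_16 -> A) (z w : 'I_16 -> A).

(** Pythagoras for the residual of [M] after projection onto the span of the [E c], scaled by [m] to
    avoid division. It thus also holds over a polynomial ring, where the left side is an explicit
    sum of squares. *)
Lemma bessel (I : finType) (m : nat) (E : I -> 'I_16 -> 'I_16 -> A) M :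
  (forall c d, frob (E c) (E d) = (c == d)%:R *+ m) ->
  \sum_(i : pr16) (M i.1 i.2 *+ m - \sum_c frob (E c) M * E c i.1 i.2) ^+ 2 =
  frob M M *+ m *+ m - (\sum_c frob (E c) M ^+ 2) *+ m.
Proof.
move=> ortho; pose x c := frob (E c) M.
have cross : \sum_(i : pr16) M i.1 i.2 * (\sum_c x c * E c i.1 i.2) =
    \sum_c x c ^+ 2.
  under eq_bigr do rewrite mulr_sumr.
  rewrite exchange_big; apply: eq_bigr => c _ /=.
  transitivity (x c * frob (E c) M); last by rewrite expr2.
  by rewrite mulr_sumr; apply: eq_bigr => i _; rewrite mulrCA [M _ _ * _]mulrC.
have sq : \sum_(i : pr16) (\sum_c x c * E c i.1 i.2) ^+ 2 =
    (\sum_c x c ^+ 2) *+ m.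
  transitivity (\sum_(i : pr16) \sum_c \sum_d
      x c * x d * (E c i.1 i.2 * E d i.1 i.2)).
    apply: eq_bigr => i _; rewrite expr2 big_distrlr.
    by apply: eq_bigr => c _; apply: eq_bigr => d _; rewrite mulrACA.
  rewrite exchange_big -sumrMnl; apply: eq_bigr => c _ /=.
  rewrite exchange_big (bigD1 c) //= [X in _ + X]big1 => [|d dc].
    by rewrite -mulr_sumr -/(frob _ _) ortho eqxx addr0 mulrnAr mulr1.
  by rewrite -mulr_sumr -/(frob _ _) ortho eq_sym (negbTE dc) mul0rn mulr0.
have [y yE] : exists y : A, forall t, t *+ m = t * y.
  by exists m%:R => t; rewrite mulr_natr.
transitivity (\sum_(i : pr16) (M i.1 i.2 * M i.1 i.2 *+ m *+ m
    - M i.1 i.2 * (\sum_c x c * E c i.1 i.2) *+ m *+ 2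
    + (\sum_c x c * E c i.1 i.2) ^+ 2)).
  by apply: eq_bigr => i _; rewrite /x !yE; ring.
rewrite !big_split /= sumrN !sumrMnl cross sq -/(frob M M).
by rewrite !yE; ring.
Qed.

Lemma frob_clif (a b : 'I_9) :
  frob (clifR A a) (clifR A b) = (a == b)%:R *+ 16.
Proof.
rewrite /frob -(pair_bigA _ (fun p q => clifR A a p q * clifR A b p q)) /=.
have := congr1 (fun t : int => t%:~R : A) (clif_ortho a b).
rewrite rmorph_sum rmorphMn /= mulrz_nat => <-; apply: eq_bigr => p _.
by rewrite rmorph_sum; apply: eq_bigr => q _; rewrite rmorphM.
Qed.

Lemma frob_clif2 (a b : 'I_36) :
  frob (clif2R A a) (clif2R A b) = (a == b)%:R *+ 16.
Proof.
rewrite /frob -(pair_bigA _ (fun p q => clif2R A a p q * clif2R A b p q)) /=.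
have := congr1 (fun t : int => t%:~R : A) (clif2_ortho a b).
rewrite rmorph_sum rmorphMn /= mulrz_nat => <-; apply: eq_bigr => p _.
by rewrite rmorph_sum; apply: eq_bigr => q _; rewrite rmorphM.
Qed.

Lemma clifR_sym a p q : clifR A a p q = clifR A a q p.
Proof. by rewrite /clifR clif_sym. Qed.

Lemma clif2R_anti c p q : clif2R A c p q = - clif2R A c q p.
Proof. by rewrite /clif2R clif2_anti rmorphN. Qed.

Definition outer z w (p q : 'I_16) : A := z p * w q.
Definition ip z w : A := \sum_p z p * w p.
Definition bil a z w : A := frob (clifR A a) (outer z w).
Definition wil c z w : A := frob (clif2R A c) (outer z w).

Lemma sum_swap_pair (F : 'I_16 -> 'I_16 -> A) :
  \sum_(i : pr16) F i.1 i.2 = \sum_(i : pr16) F i.2 i.1.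
Proof.
by rewrite -(pair_bigA _ F) exchange_big (pair_bigA _ (fun p q => F q p)).
Qed.

Lemma frobC M N : frob M N = frob N M.
Proof. by apply: eq_bigr => i _; rewrite mulrC. Qed.

Lemma ipC z w : ip z w = ip w z.
Proof. by apply: eq_bigr => p _; rewrite mulrC. Qed.

Lemma bilC a z w : bil a z w = bil a w z.
Proof.
rewrite /bil /frob (sum_swap_pair (fun p q => _ p q * _ p q)); apply: eq_bigr => i _.
by rewrite clifR_sym /outer [z _ * _]mulrC.
Qed.

Lemma wilC c z w : wil c z w = - wil c w z.
Proof.
rewrite /wil /frob (sum_swap_pair (fun p q => _ p q * _ p q)) -sumrN; apply: eq_bigr => i _.
by rewrite clif2R_anti /outer [z _ * _]mulrC mulNr.
Qed.

Lemma mtrace_outer z w : mtrace (outer z w) = ip z w. Proof. by []. Qed.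

Lemma frob_outer z w z' w' :
  frob (outer z w) (outer z' w') = ip z z' * ip w w'.
Proof.
rewrite /frob /ip big_distrlr pair_bigA /=; apply: eq_bigr => i _.
by rewrite /outer mulrACA.
Qed.

Lemma sandwich_outer z w z' w' : sandwich (outer z w) (outer z' w') =
  \sum_a bil a z z' * bil a w w'.
Proof.
apply: eq_bigr => a _; rewrite /bil /frob.
rewrite -(pair_bigA _ (fun p q => clifR A a p q * outer z z' p q)) /=.
rewrite -(pair_bigA _ (fun p q => clifR A a p q * outer w w' p q)) /= big_distrlr /=.
rewrite -(pair_bigA _ (fun p q => \sum_(j : pr16)
  clifR A a p j.1 * clifR A a q j.2 * (outer z w p q * outer z' w' j.1 j.2))) /=.
apply: eq_bigr => p _; apply: eq_bigr => q _; rewrite big_distrlr pair_bigA.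
by apply: eq_bigr => j _ /=; rewrite /outer; ring.
Qed.

(** The Fierz identity for the rank one matrices z z^T and w w^T: these are symmetric, so the
    antisymmetric products S_a S_b drop out. *)
Lemma bil_fierz z w : (\sum_a bil a z w ^+ 2) *+ 4 =
  (ip z z * ip w w) *+ 2 - (\sum_a bil a z z * bil a w w) *+ 2
  + (ip z w ^+ 2) *+ 4.
Proof.
have := sandwichE (outer z z) (outer w w).
rewrite sandwich_outer !mtrace_outer frob_outer.
have -> : frob (outer z z) (fun p q => outer w w q p) = ip z w ^+ 2.
  by rewrite expr2 -frob_outer; apply: eq_bigr => i _; rewrite /outer [w i.2 * _]mulrC.
under eq_bigr do rewrite -expr2.
move=> /(congr1 (fun t => t *+ 2)); rewrite -mulrnA => ->.
(* In a general ring antisymmetry only gives [wil c z z *+ 2 = 0], hence the doubling just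
   before. *)
have W2 : (\sum_c frob (clif2R A c) (outer z z) * frob (clif2R A c) (outer w w)) *+ 2 = 0.
  rewrite -sumrMnl big1 // => c _; rewrite -mulrnAl -/(wil c z z).
  by rewrite mulr2n {1}wilC addNr mul0r.
move: W2; rewrite /bil; move: (\sum_c _) (\sum_a _) => t u t0; ring: t0.
Qed.

(** The Fierz identity with both matrices equal to z w^T, solved for the terms in S_a S_b. *)
Lemma wil_fierz z w : \sum_c wil c z w ^+ 2 =
  (\sum_a bil a z z * bil a w w) *+ 2 + \sum_a bil a z w ^+ 2
  + (ip z z * ip w w) *+ 2 - (ip z w ^+ 2) *+ 5.
Proof.
have := sandwichE (outer z w) (outer z w).
rewrite sandwich_outer !mtrace_outer frob_outer.
have -> : frob (outer z w) (fun p q => outer z w q p) = ip z w ^+ 2.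
  rewrite expr2 {2}ipC -frob_outer; apply: eq_bigr => i _.
  by rewrite /outer [z i.2 * _]mulrC.
have sqE (I : finType) (F : I -> A) : \sum_i F i ^+ 2 = \sum_i F i * F i.
  by apply: eq_bigr => j _; rewrite expr2.
rewrite !sqE /bil /wil => E; ring: E.
Qed.

Definition wedge z w (p q : 'I_16) : A := z p * w q - z q * w p.

Lemma frob_clif2_wedge c z w : frob (clif2R A c) (wedge z w) = wil c z w *+ 2.
Proof.
rewrite mulr2n {2}wilC /wil /frob -sumrN -big_split; apply: eq_bigr => i _ /=.
by rewrite /wedge /outer mulrBr [z i.2 * _]mulrC.
Qed.

(** Lagrange's identity; each 2 x 2 minor occurs for both orders of its columns, whence the factor
    2. *)
Lemma frob_wedge z w : frob (wedge z w) (wedge z w) =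
  (ip z z * ip w w - ip z w ^+ 2) *+ 2.
Proof.
have E1 : ip z z * ip w w = \sum_(i : pr16) (z i.1 * w i.2) ^+ 2.
  by rewrite -frob_outer; apply: eq_bigr => i _; rewrite /outer; ring.
have E2 : ip z w ^+ 2 = \sum_(i : pr16) z i.1 * w i.2 * (z i.2 * w i.1).
  by rewrite expr2 {2}ipC -frob_outer; apply: eq_bigr => i _; rewrite /outer; ring.
rewrite mulrnBl mulr2n {1}E1 (sum_swap_pair (fun p q => (z p * w q) ^+ 2)) E1 E2.
rewrite -sumrMnl -big_split -sumrB; apply: eq_bigr => i _ /=.
by rewrite /wedge; ring.
Qed.

End Bilinear.

(** * The sum of squares certificate *)

Section Certificate.
Context (A : comNzRingType) (k : nat).
Implicit Types Z W : 'I_k -> 'I_16 -> A.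

Definition vip Z W : A := \sum_i ip (Z i) (W i).
Definition vbil a Z W : A := \sum_i bil a (Z i) (W i).

(** [k] times the traceless part of the symmetric k x k matrix with entries z_i^T S_a z_j. *)
Definition diag_square Z a i j : A :=
  bil a (Z i) (Z j) * k%:R - vbil a Z Z * (i == j)%:R.

(** 16 times the component of z_i /\ z_j orthogonal to spin(9), the span of the S_a S_b in
    so(16). *)
Definition wedge_square Z i j (x : pr16) : A :=
  wedge (Z i) (Z j) x.1 x.2 *+ 16
  - \sum_c frob (clif2R A c) (wedge (Z i) (Z j)) * clif2R A c x.1 x.2.

Lemma diag_squareE Z a : \sum_i \sum_j diag_square Z a i j ^+ 2 =
  k%:R * (k%:R * (\sum_i \sum_j bil a (Z i) (Z j) ^+ 2) - vbil a Z Z ^+ 2).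
Proof.
set s := vbil a Z Z.
transitivity (\sum_i (k%:R ^+ 2 * (\sum_j bil a (Z i) (Z j) ^+ 2)
   - k%:R * s *+ 2 * bil a (Z i) (Z i) + s ^+ 2)).
  apply: eq_bigr => i _; rewrite (bigD1 i) //= [in RHS](bigD1 i) //= mulrDr.
  rewrite [X in _ + X](_ : _ = k%:R ^+ 2 * \sum_(j | j != i) bil a (Z i) (Z j) ^+ 2).
    by rewrite /diag_square -/s eqxx mulr1; ring.
  rewrite mulr_sumr; apply: eq_bigr => j ji.
  by rewrite /diag_square eq_sym (negbTE ji) mulr0; ring.
rewrite !big_split /= sumrN.
have -> : \sum_(i < k) s ^+ 2 = k%:R * s ^+ 2.
  by rewrite sumr_const card_ord mulr_natl.
rewrite -!mulr_sumr -/(vbil a Z Z) -/s; ring.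
Qed.

(** [bessel] leaves the norm of the wedge minus the [wil] terms; [wil_fierz] and then [bil_fierz]
    eliminate [wil] and [ip (Z i) (Z j)]. *)
Lemma wedge_squareE Z i j : \sum_x wedge_square Z i j x ^+ 2 *+ 2 =
  ((ip (Z i) (Z i) * ip (Z j) (Z j)) *+ 15
   - (\sum_a bil a (Z i) (Z i) * bil a (Z j) (Z j)) *+ 7
   - (\sum_a bil a (Z i) (Z j) ^+ 2) *+ 8) *+ 64.
Proof.
rewrite sumrMnl (bessel _ (@frob_clif2 A)) frob_wedge.
under eq_bigr do rewrite frob_clif2_wedge -mulr_natr exprMn.
rewrite -mulr_suml wil_fierz; have := bil_fierz (Z i) (Z j).
move: (\sum_a bil a (Z i) (Z i) * _) (\sum_a bil a (Z i) (Z j) ^+ 2) (ip _ _) (ip _ _) (ip _ _).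
move=> x y d n m /eqP; rewrite -subr_eq0 => /eqP E.

(* The sides differ by 96 times [bil_fierz]: the left one contains the squared inner product with
   coefficient -384 = -4 * 96. *)
rewrite -[RHS]addr0 -[X in _ = _ + X](mul0rn _ 96) -E; ring.
Qed.

(* c |z|^4 - |Q|^2 with c = 15k/(7k+8), cleared of denominators. *)
Lemma gap_certificate Z :
  (vip Z Z ^+ 2 * (15 * k%:R) - (\sum_a vbil a Z Z ^+ 2) * (7 * k%:R + 8))
    * (64 * k%:R) =
  512 * (\sum_a \sum_i \sum_j diag_square Z a i j ^+ 2)
  + 2 * k%:R ^+ 2 * (\sum_i \sum_j \sum_x wedge_square Z i j x ^+ 2).
Proof.
(* The weights 512 and [2 * k%:R ^+ 2] make the sums of [bil a (Z i) (Z j) ^+ 2] cancel between the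
   two families of squares. *)
have -> : 2 * k%:R ^+ 2 * (\sum_i \sum_j \sum_x wedge_square Z i j x ^+ 2) =
  k%:R ^+ 2 * 64 * (15 * vip Z Z ^+ 2 - 7 * (\sum_a vbil a Z Z ^+ 2)
    - 8 * \sum_a \sum_i \sum_j bil a (Z i) (Z j) ^+ 2).
  have -> : vip Z Z ^+ 2 = \sum_i \sum_j ip (Z i) (Z i) * ip (Z j) (Z j).
    by rewrite expr2 big_distrlr.
  have -> : \sum_a vbil a Z Z ^+ 2 =
      \sum_i \sum_j \sum_a bil a (Z i) (Z i) * bil a (Z j) (Z j).
    under eq_bigr do rewrite expr2 big_distrlr.
    by rewrite exchange_big; apply: eq_bigr => i _; rewrite exchange_big.
  have -> : \sum_a \sum_i \sum_j bil a (Z i) (Z j) ^+ 2 =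
      \sum_i \sum_j \sum_a bil a (Z i) (Z j) ^+ 2.
    by rewrite exchange_big; apply: eq_bigr => i _; rewrite exchange_big.
  rewrite [2 * _]mulrC -!mulrA; do 2!congr (_ * _).
  rewrite !mulr_sumr -!sumrB mulr_sumr; apply: eq_bigr => i _.
  rewrite !mulr_sumr -!sumrB mulr_sumr; apply: eq_bigr => j _.
  have := wedge_squareE Z i j; rewrite sumrMnl => E; ring: E.
under [X in 512 * X]eq_bigr do rewrite diag_squareE.
rewrite -mulr_sumr sumrB -mulr_sumr; ring.
Qed.

End Certificate.

(** * Norm inequalities for Q over the reals *)

Section RealInequalities.
Context (R : rcfType).

Lemma sum_cauchy_schwarz (I : finType) (u v : I -> R) :
  (\sum_i u i * v i) ^+ 2 <= (\sum_i u i ^+ 2) * (\sum_i v i ^+ 2).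
Proof.
rewrite -subr_ge0.
suff -> : (\sum_i u i ^+ 2) * (\sum_i v i ^+ 2) - (\sum_i u i * v i) ^+ 2 =
    \sum_i \sum_j (u i * v j - u j * v i) ^+ 2 / 2.
  by apply: sumr_ge0 => i _; apply: sumr_ge0 => j _; rewrite divr_ge0 ?sqr_ge0.
have E1 : (\sum_i u i ^+ 2) * (\sum_i v i ^+ 2) =
    \sum_i \sum_j u i ^+ 2 * v j ^+ 2 by rewrite big_distrlr.
have E2 : (\sum_i u i * v i) ^+ 2 = \sum_i \sum_j (u i * v i) * (u j * v j).
  by rewrite expr2 big_distrlr.
have E3 : (\sum_i u i ^+ 2) * (\sum_i v i ^+ 2) =
    \sum_i \sum_j u j ^+ 2 * v i ^+ 2 by rewrite E1 exchange_big.
transitivity (2^-1 * ((\sum_i u i ^+ 2) * (\sum_i v i ^+ 2))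
  + 2^-1 * ((\sum_i u i ^+ 2) * (\sum_i v i ^+ 2)) - (\sum_i u i * v i) ^+ 2).
  by field.
rewrite {1}E1 E3 E2 !mulr_sumr -big_split -sumrB; apply: eq_bigr => i _ /=.
rewrite !mulr_sumr -big_split -sumrB; apply: eq_bigr => j _ /=.
by field.
Qed.

(** |q(z)| = |z|^2, the norm property of the Hopf map from R^16 to R^9. At w = z the Fierz identity
    reads 6 |q|^2 = 6 |z|^4. *)
Lemma bil_diag_norm (z : 'I_16 -> R) : \sum_a bil a z z ^+ 2 = ip z z ^+ 2.
Proof.
have sqE : \sum_a bil a z z * bil a z z = \sum_a bil a z z ^+ 2.
  by apply: eq_bigr => a _; rewrite expr2.
have := bil_fierz z z; rewrite sqE.
by move: (\sum_a _) (ip z z) => x y E; lra.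
Qed.

Lemma ip_ge0 (z : 'I_16 -> R) : 0 <= ip z z.
Proof. by apply: sumr_ge0 => p _; rewrite -expr2 sqr_ge0. Qed.

Lemma bil_diag_le (z w : 'I_16 -> R) :
  \sum_a bil a z z * bil a w w <= ip z z * ip w w.
Proof.
have := sum_cauchy_schwarz (fun a => bil a z z) (fun a => bil a w w).
rewrite !bil_diag_norm -exprMn => le2.
have ge0 : 0 <= ip z z * ip w w by rewrite mulr_ge0 ?ip_ge0.
apply: le_trans (ler_norm _) _; rewrite -(ler_pXn2r (n := 2)) ?nnegrE //.
by rewrite real_normK ?num_real.
Qed.

Context (k : nat).
Implicit Types Z W P : 'I_k -> 'I_16 -> R.

(** The triangle inequality |Q| <= \sum_i |q(z_i)|, squared and expanded over pairs. *)
Lemma vbil_diag_le Z : \sum_a vbil a Z Z ^+ 2 <= vip Z Z ^+ 2.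
Proof.
rewrite expr2 [leRHS]big_distrlr /=.
under eq_bigr do rewrite expr2 big_distrlr.
rewrite exchange_big; apply: ler_sum => i _ /=.
by rewrite exchange_big; apply: ler_sum => j _; exact: bil_diag_le.
Qed.

Lemma vip_ge0 Z : 0 <= vip Z Z.
Proof. by apply: sumr_ge0 => i _; exact: ip_ge0. Qed.

Definition comb (x y : R) Z W i p : R := x * Z i p + y * W i p.

Lemma vip_comb x y x' y' Z W :
  vip (comb x y Z W) (comb x' y' Z W) =
  x * x' * vip Z Z + (x * y' + y * x') * vip Z W + y * y' * vip W W.
Proof.
rewrite /vip !mulr_sumr -!big_split; apply: eq_bigr => i _ /=.
rewrite /ip !mulr_sumr -!big_split; apply: eq_bigr => p _ /=.
by rewrite /comb; ring.
Qed.

Lemma vbil_comb a x y x' y' Z W :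
  vbil a (comb x y Z W) (comb x' y' Z W) =
  x * x' * vbil a Z Z + (x * y' + y * x') * vbil a Z W + y * y' * vbil a W W.
Proof.
have split2 : (x * y' + y * x') * vbil a Z W =
    x * y' * vbil a Z W + y * x' * \sum_i bil a (W i) (Z i).
  by rewrite mulrDl; congr (_ + _ * _); apply: eq_bigr => i _; exact: bilC.
rewrite split2 /vbil !mulr_sumr -!big_split; apply: eq_bigr => i _ /=.
rewrite /bil /frob !mulr_sumr -!big_split; apply: eq_bigr => p _ /=.
by rewrite /comb /outer; ring.
Qed.

Lemma vip_eq0 Z : vip Z Z = 0 -> forall i p, Z i p = 0.
Proof.
move/eqP; rewrite psumr_eq0 => [|i _]; last exact: ip_ge0.
move=> /allP Z0 i p; have /eqP := Z0 i (mem_index_enum i) => /eqP.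
rewrite psumr_eq0 => [|q _]; last by rewrite -expr2 sqr_ge0.
by move=> /allP/(_ p (mem_index_enum p)); rewrite mulf_eq0 orbb => /eqP.
Qed.

(** The bound behind convexity. If neither argument vanishes, [vbil_diag_le] is added up at two
    combinations of [Z] and [W] that differ by a sign, and the nonnegative terms in |Q(Z)|^2 and
    |Q(W)|^2 are dropped. *)
Lemma vbil_hessian Z W :
  (\sum_a vbil a Z W ^+ 2) * 2 + \sum_a vbil a Z Z * vbil a W W <=
  2 * (vip Z Z * vip W W) + 2 * vip Z W ^+ 2.
Proof.
have [|nz] := eqVneq (vip Z Z * vip W W) 0.
  move=> /eqP; rewrite mulf_eq0 => nz.
  have ZW0 i p q : Z i p * W i q = 0.
    by case/orP: nz => /eqP/vip_eq0 ->; rewrite ?mul0r ?mulr0.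
  have b0 a : vbil a Z W = 0.
    rewrite /vbil big1 // => i _; rewrite /bil /frob big1 // => x _.
    by rewrite /outer ZW0 mulr0.
  have bb0 : \sum_a vbil a Z Z * vbil a W W = 0.
    apply: big1 => a _; case/orP: nz => /eqP/vip_eq0 e0; apply/eqP;
      rewrite mulf_eq0; apply/orP; [left|right]; apply/eqP;
      rewrite /vbil big1 // => i _; rewrite /bil /frob big1 // => x _;
      by rewrite /outer e0 mul0r mulr0.
  rewrite bb0 big1 => [|a _]; last by rewrite b0 expr0n.
  rewrite mul0r addr0 addr_ge0 // mulr_ge0 ?sqr_ge0 // mulr_ge0 ?vip_ge0 //.
set N := vip Z Z in nz *; set n := vip W W in nz *.
have N0 : 0 <= N := vip_ge0 Z; have n0 : 0 <= n := vip_ge0 W.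
have Nn0 : 0 < N * n by rewrite lt_def nz mulr_ge0.
have [vZ vW] : vip Z Z = N /\ vip W W = n by [].
clearbody N n.
have [l l2] : exists l, l ^+ 2 = N by exists (Num.sqrt N); rewrite sqr_sqrtr.
have [mu m2] : exists mu, mu ^+ 2 = n by exists (Num.sqrt n); rewrite sqr_sqrtr.
pose S1 := \sum_a vbil a Z W * (n * vbil a Z Z + N * vbil a W W).
(* The sign [e] affects only the term in [S1], which cancels between e = 1 and e = -1. *)
have sq (e : R) : e ^+ 2 = 1 ->
    \sum_a vbil a (comb mu (e * l) Z W) (comb mu (e * l) Z W) ^+ 2 =
    n ^+ 2 * (\sum_a vbil a Z Z ^+ 2) + e * (4 * mu * l) * S1
    + (N * n * 4) * (\sum_a vbil a Z W ^+ 2)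
    + (N * n * 2) * (\sum_a vbil a Z Z * vbil a W W)
    + N ^+ 2 * (\sum_a vbil a W W ^+ 2).
  move=> e1; rewrite /S1 !mulr_sumr -!big_split; apply: eq_bigr => a _ /=.
  rewrite vbil_comb -l2 -m2.
  move: (vbil a Z Z) (vbil a Z W) (vbil a W W) => x y z.
  move/eqP: e1; rewrite sqrf_eq1 => /orP[]/eqP ->; ring.
(* |Q|^2 <= |.|^4 at mu Z + l W and mu Z - l W, which balance the two norms. *)
have h1 := vbil_diag_le (comb mu (1 * l) Z W).
have h2 := vbil_diag_le (comb mu (-1 * l) Z W).
move: h1 h2; rewrite !sq ?sqrrN ?expr1n // !vip_comb ?vZ ?vW; clear sq.
have Q0 : 0 <= n ^+ 2 * (\sum_a vbil a Z Z ^+ 2).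
  by rewrite mulr_ge0 ?sqr_ge0 // sumr_ge0 // => a _; exact: sqr_ge0.
have q0 : 0 <= N ^+ 2 * (\sum_a vbil a W W ^+ 2).
  by rewrite mulr_ge0 ?sqr_ge0 // sumr_ge0 // => a _; exact: sqr_ge0.
move: (n ^+ 2 * _) (N ^+ 2 * _) (\sum_a vbil a Z W ^+ 2)
  (\sum_a vbil a Z Z * vbil a W W) S1 (vip Z W) Q0 q0.
move=> Q2 q2 M2 x y d Q0 q0 h1 h2.
rewrite -(ler_pM2l Nn0).
have e1 : (mu * mu * N + (mu * (1 * l) + 1 * l * mu) * d + 1 * l * (1 * l) * n) ^+ 2
  + (mu * mu * N + (mu * (-1 * l) + -1 * l * mu) * d + -1 * l * (-1 * l) * n) ^+ 2
  = N * n * (8 * (N * n) + 8 * d ^+ 2) by rewrite -l2 -m2; ring.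
lra.
Qed.

End RealInequalities.

(** * Convexity of 2 |z|^4 - |Q|^2 along lines *)

Section Convexity.
Context (R : rcfType) (k : nat).
Implicit Types Z W P : 'I_k -> 'I_16 -> R.

(** At c = 1 this is four times the Cauchy-Schwarz form, at c = 2 four times the form to be proved
    convex. *)
Definition cquartic (c : R) Z : R := c * vip Z Z ^+ 2 - \sum_a vbil a Z Z ^+ 2.

Definition cquartic_coef2 Z W : R :=
  8 * vip Z W ^+ 2 + 4 * (vip Z Z * vip W W)
  - 4 * (\sum_a vbil a Z W ^+ 2) - 2 * \sum_a vbil a Z Z * vbil a W W.

Definition cquartic_coef3 Z W : R :=
  8 * vip Z W * vip W W - 4 * \sum_a vbil a Z W * vbil a W W.

Lemma cquartic_line t P W : cquartic 2 (comb 1 t P W) =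
  cquartic 2 P
  + t * (8 * vip P P * vip P W - 4 * \sum_a vbil a P P * vbil a P W)
  + t ^+ 2 * cquartic_coef2 P W + t ^+ 3 * cquartic_coef3 P W + t ^+ 4 * cquartic 2 W.
Proof.
rewrite /cquartic /cquartic_coef2 /cquartic_coef3 vip_comb.
have -> : \sum_a vbil a (comb 1 t P W) (comb 1 t P W) ^+ 2 =
    (\sum_a vbil a P P ^+ 2) + t * 4 * (\sum_a vbil a P P * vbil a P W)
    + t ^+ 2 * 4 * (\sum_a vbil a P W ^+ 2)
    + t ^+ 2 * 2 * (\sum_a vbil a P P * vbil a W W)
    + t ^+ 3 * 4 * (\sum_a vbil a P W * vbil a W W)
    + t ^+ 4 * \sum_a vbil a W W ^+ 2.
  rewrite !mulr_sumr -!big_split; apply: eq_bigr => a _ /=.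
  by rewrite vbil_comb; ring.
by ring.
Qed.

(** [cquartic_coef2] is half the second derivative in the direction [W], so this is half the second
    derivative in [t] of the quartic in [cquartic_line]. *)
Lemma cquartic_coef2_line t P W :
  cquartic_coef2 (comb 1 t P W) W = cquartic_coef2 P W + t * 3 * cquartic_coef3 P W + t ^+ 2 * 6 * cquartic 2 W.
Proof.
have EW : W = comb 0 1 P W.
  by apply/funext => i; apply/funext => p; rewrite /comb mul0r add0r mul1r.
have vW : vip (comb 1 t P W) W = vip P W + t * vip W W.
  by rewrite {2}EW vip_comb; ring.
have bW a : vbil a (comb 1 t P W) W = vbil a P W + t * vbil a W W.
  by rewrite {2}EW vbil_comb; ring.
have -> : cquartic_coef2 (comb 1 t P W) W = 8 * (vip P W + t * vip W W) ^+ 2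
    + 4 * ((vip P P + 2 * t * vip P W + t ^+ 2 * vip W W) * vip W W)
    - (4 * (\sum_a vbil a P W ^+ 2) + 8 * t * (\sum_a vbil a P W * vbil a W W)
        + 4 * t ^+ 2 * \sum_a vbil a W W ^+ 2)
    - (2 * (\sum_a vbil a P P * vbil a W W)
        + 4 * t * (\sum_a vbil a P W * vbil a W W)
        + 2 * t ^+ 2 * \sum_a vbil a W W ^+ 2).
  rewrite /cquartic_coef2 vW vip_comb; congr (_ + _ * (_ * _) - _ - _); first ring.
    rewrite !mulr_sumr -!big_split; apply: eq_bigr => a _ /=.
    by rewrite bW; ring.
  rewrite !mulr_sumr -!big_split; apply: eq_bigr => a _ /=.
  by rewrite vbil_comb; ring.
by rewrite /cquartic_coef2 /cquartic_coef3 /cquartic; ring.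
Qed.

Lemma cquartic_coef2_ge0 P W : 0 <= cquartic_coef2 P W.
Proof.
have := vbil_hessian P W; have := sqr_ge0 (vip P W); rewrite /cquartic_coef2; lra.
Qed.

Lemma cquartic_convex (x y : R) Z W : 0 <= x -> 0 <= y -> x + y = 1 ->
  cquartic 2 (comb x y Z W) <= x * cquartic 2 Z + y * cquartic 2 W.
Proof.
move=> x0 y0 xy1.
set P := comb x y Z W; pose V := comb 1 (-1) Z W.
have EZ : Z = comb 1 y P V.
  apply/funext => i; apply/funext => p; rewrite /P /V /comb.
  have -> : x = 1 - y by lra.
  ring.
have EW : W = comb 1 (- x) P V.
  apply/funext => i; apply/funext => p; rewrite /P /V /comb.
  have -> : y = 1 - x by lra.
  ring.
have c4 : 0 <= cquartic 2 V.
  rewrite /cquartic; have := vbil_diag_le V; have := sqr_ge0 (vip V V).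
  by move: (\sum_a _) (_ ^+ 2) => u v; lra.
(* The convexity defect is xy (c2 + (y - x) c3 + (x^2 - xy + y^2) c4), with c_i the
   coefficient of t^i along P + t V; the Hessian at t = (y - x) / 3 bounds
   c2 + (y - x) c3 from below. *)
clearbody P V; have := cquartic_coef2_ge0 (comb 1 ((y - x) / 3) P V) V.
have -> : cquartic 2 Z = cquartic 2 (comb 1 y P V) by rewrite -EZ.
have -> : cquartic 2 W = cquartic 2 (comb 1 (- x) P V) by rewrite -EW.
rewrite cquartic_coef2_line !cquartic_line; move: c4.
move: (cquartic 2 P) (cquartic 2 V) (cquartic_coef2 P V) (cquartic_coef3 P V) (8 * _ * _ - _) => c0 c4 c2 c3 c1.
have -> : y = 1 - x by lra.
move=> c40 h; rewrite -subr_ge0.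
have -> : x * (c0 + (1 - x) * c1 + (1 - x) ^+ 2 * c2 + (1 - x) ^+ 3 * c3
    + (1 - x) ^+ 4 * c4) + (1 - x) * (c0 + - x * c1 + (- x) ^+ 2 * c2
    + (- x) ^+ 3 * c3 + (- x) ^+ 4 * c4) - c0 =
  x * (1 - x) * ((c2 + (1 - x - x) / 3 * 3 * c3
     + ((1 - x - x) / 3) ^+ 2 * 6 * c4) + (1 - x * (1 - x)) / 3 * c4) by field.
have x1 : 0 <= 1 - x by lra.
rewrite mulr_ge0 ?mulr_ge0 // addr_ge0 // mulr_ge0 //; nra.
Qed.

End Convexity.

(** * The dual fourth order operator and its positivity on squares *)

Section DualForm.
Context (R : realFieldType) (k : nat).
Notation Ix := ('I_k * 'I_16)%type.
Implicit Types (H : Ix -> Ix -> R) (N : 'I_16 -> 'I_16 -> R).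

(* For D the fourth derivatives of f, this is (5 L^2 + \sum_a L_a^2
   + 4 \sum_ij L_ij^2) f, where L, L_a, L_ij have symbols |z|^2, z^T S_a z and
   z_i . z_j.  The weights 5, 1, 4 make block_form vanish on the S_a and on the
   products S_a S_b S_c, the two families used by the sum of squares
   certificate. *)
Definition quartic_op (D : Ix -> Ix -> Ix -> Ix -> R) : R :=
  \sum_(i < k) \sum_(j < k) (
    5 * (\sum_(p < 16) \sum_(r < 16) D (i, p) (i, p) (j, r) (j, r))
    + (\sum_a \sum_(x : pr16) \sum_(y : pr16)
         clifR R a x.1 x.2 * clifR R a y.1 y.2
         * D (i, x.1) (i, x.2) (j, y.1) (j, y.2))
    + 4 * (\sum_(p < 16) \sum_(r < 16) D (i, p) (i, r) (j, p) (j, r))).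

Definition block H i j p r : R := H (i, p) (j, r).
Definition diag_sum H p r : R := \sum_i H (i, p) (i, r).

Definition block_form N : R :=
  8 * frob N N + 8 * frob N (fun p q => N q p) + 5 * mtrace N ^+ 2
  - \sum_a frob (clifR R a) N ^+ 2 + \sum_c frob (clif2R R c) N ^+ 2.

Definition dual_form H : R :=
  5 * mtrace (diag_sum H) ^+ 2 + \sum_a frob (clifR R a) (diag_sum H) ^+ 2
  + 4 * frob (diag_sum H) (diag_sum H) + \sum_i \sum_j block_form (block H i j).

(** The argument is the fourth derivative at 0 of q^2, for q vanishing to order 2 with Hessian [H].
    Pairing the two indices in block i with each other yields the diagonal sums; the two other
    pairings yield the blocks, where [sandwichE] rewrites the term in S_a (x) S_a. *)
Lemma quartic_op_square H : (forall a b, H a b = H b a) ->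
  quartic_op (fun a b c d => 2 * (H a b * H c d + H a c * H b d + H a d * H b c))
  = 2 * dual_form H.
Proof.
move=> symH.
have t1 : mtrace (diag_sum H) ^+ 2 = \sum_i \sum_j \sum_p \sum_r
    H (i, p) (i, p) * H (j, r) (j, r).
  rewrite /mtrace /diag_sum exchange_big expr2 big_distrlr /=.
  by apply: eq_bigr => i _; apply: eq_bigr => j _; rewrite big_distrlr.
have t2 : \sum_a frob (clifR R a) (diag_sum H) ^+ 2 = \sum_i \sum_j \sum_a
    \sum_(x : pr16) \sum_(y : pr16) clifR R a x.1 x.2 * clifR R a y.1 y.2 *
    (H (i, x.1) (i, x.2) * H (j, y.1) (j, y.2)).
  transitivity (\sum_a \sum_i \sum_j
    \sum_(x : pr16) \sum_(y : pr16) clifR R a x.1 x.2 * clifR R a y.1 y.2 *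
    (H (i, x.1) (i, x.2) * H (j, y.1) (j, y.2))); last first.
    by rewrite exchange_big; apply: eq_bigr => i _; rewrite exchange_big.
  apply: eq_bigr => a _; rewrite /frob /diag_sum.
  under eq_bigr do rewrite mulr_sumr.
  rewrite exchange_big expr2 big_distrlr /=.
  apply: eq_bigr => i _; apply: eq_bigr => j _; rewrite big_distrlr /=.
  by apply: eq_bigr => x _; apply: eq_bigr => y _; rewrite mulrACA.
have t3 : frob (diag_sum H) (diag_sum H) = \sum_i \sum_j \sum_p \sum_r
    H (i, p) (i, r) * H (j, p) (j, r).
  transitivity (\sum_(x : pr16) \sum_(ij : 'I_k * 'I_k)
      H (ij.1, x.1) (ij.1, x.2) * H (ij.2, x.1) (ij.2, x.2)).
    by apply: eq_bigr => x _; rewrite big_distrlr pair_bigA.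
  rewrite exchange_big -(pair_bigA _ (fun i j => \sum_(x : pr16)
    H (i, x.1) (i, x.2) * H (j, x.1) (j, x.2))) /=.
  by apply: eq_bigr => i _; apply: eq_bigr => j _; rewrite pair_bigA.
have b1 i j : frob (block H i j) (block H i j) =
    \sum_p \sum_r H (i, p) (j, r) * H (i, p) (j, r).
  by rewrite pair_bigA.
have b2 i j : frob (block H i j) (fun p q => block H i j q p) =
    \sum_p \sum_r H (i, p) (j, r) * H (i, r) (j, p).
  by rewrite pair_bigA.
have b3 i j : mtrace (block H i j) ^+ 2 =
    \sum_p \sum_r H (i, p) (j, p) * H (i, r) (j, r).
  by rewrite expr2 big_distrlr.
have b4 i j : \sum_a \sum_(x : pr16) \sum_(y : pr16)
    clifR R a x.1 x.2 * clifR R a y.1 y.2 *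
    (H (i, x.1) (j, y.1) * H (i, x.2) (j, y.2)) =
    sandwich (block H i j) (block H i j).
  apply: eq_bigr => a _.
  rewrite -(pair_bigA _ (fun p q => \sum_(y : pr16) clifR R a p q *
    clifR R a y.1 y.2 * (H (i, p) (j, y.1) * H (i, q) (j, y.2)))) /=.
  rewrite -(pair_bigA _ (fun p q => \sum_(y : pr16) clifR R a p y.1 *
    clifR R a q y.2 * (block H i j p q * block H i j y.1 y.2))) /=.
  apply: eq_bigr => p _.
  under eq_bigr => q _ do rewrite -(pair_bigA _ (fun r u => clifR R a p q *
    clifR R a r u * (H (i, p) (j, r) * H (i, q) (j, u)))) /=.
  rewrite exchange_big; apply: eq_bigr => q _; rewrite pair_bigA /=.
  by apply: eq_bigr => -[r u] _.
(* The third pairing equals the second because S_a is symmetric. *)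
have b5 i j : \sum_a \sum_(x : pr16) \sum_(y : pr16)
    clifR R a x.1 x.2 * clifR R a y.1 y.2 *
    (H (i, x.1) (j, y.2) * H (i, x.2) (j, y.1)) =
    sandwich (block H i j) (block H i j).
  rewrite -b4; apply: eq_bigr => a _; apply: eq_bigr => -[x1 x2] _ /=.
  rewrite (sum_swap_pair (fun r u => clifR R a x1 x2 * clifR R a r u *
    (H (i, x1) (j, u) * H (i, x2) (j, r)))).
  by apply: eq_bigr => y _; rewrite (clifR_sym _ a y.1 y.2).
rewrite /dual_form t1 t2 t3 !mulr_sumr -!big_split mulr_sumr.
apply: eq_bigr => i _ /=; rewrite !mulr_sumr -!big_split mulr_sumr.
apply: eq_bigr => j _ /=.
have := sandwichE (block H i j) (block H i j).
have sqE (I : finType) (F : I -> R) : \sum_i F i * F i = \sum_i F i ^+ 2.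
  by apply: eq_bigr.
rewrite !sqE /block_form => sE.
rewrite (_ : \sum_p \sum_r 2 * (H (i, p) (i, p) * H (j, r) (j, r) +
    H (i, p) (j, r) * H (i, p) (j, r) + H (i, p) (j, r) * H (i, p) (j, r)) =
  2 * (\sum_p \sum_r H (i, p) (i, p) * H (j, r) (j, r))
  + 4 * frob (block H i j) (block H i j)); last first.
  rewrite b1 !mulr_sumr -big_split; apply: eq_bigr => p _ /=.
  by rewrite !mulr_sumr -big_split; apply: eq_bigr => r _ /=; ring.
rewrite (_ : \sum_p \sum_r 2 * (H (i, p) (i, r) * H (j, p) (j, r) +
    H (i, p) (j, p) * H (i, r) (j, r) + H (i, p) (j, r) * H (i, r) (j, p)) =
  2 * (\sum_p \sum_r H (i, p) (i, r) * H (j, p) (j, r))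
  + 2 * mtrace (block H i j) ^+ 2
  + 2 * frob (block H i j) (fun p q => block H i j q p)); last first.
  rewrite b2 b3 !mulr_sumr -!big_split; apply: eq_bigr => p _ /=.
  by rewrite !mulr_sumr -!big_split; apply: eq_bigr => r _ /=; ring.
rewrite (_ : \sum_a \sum_x \sum_y _ = 2 * (\sum_a \sum_(x : pr16) \sum_(y : pr16)
    clifR R a x.1 x.2 * clifR R a y.1 y.2 *
    (H (i, x.1) (i, x.2) * H (j, y.1) (j, y.2)))
   + 4 * sandwich (block H i j) (block H i j)); last first.
  rewrite (_ : 4 * sandwich (block H i j) (block H i j) =
    2 * sandwich (block H i j) (block H i j)
    + 2 * sandwich (block H i j) (block H i j)); last by ring.
  rewrite -{1}b4 -b5 !mulr_sumr -!big_split; apply: eq_bigr => a _ /=.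
  rewrite !mulr_sumr -!big_split; apply: eq_bigr => x _ /=.
  by rewrite !mulr_sumr -!big_split; apply: eq_bigr => y _ /=; ring.
move: sE; move: (sandwich _ _) => s sE.
have -> : 4 * s = 2 * (s *+ 2) by ring.
by rewrite sE; ring.
Qed.

Lemma block_form_ge0 N : 0 <= block_form N.
Proof.
(* Bessel for the S_a, applied to the symmetric part of N. *)
pose M p q := N p q + N q p.
have MM : frob M M = 2 * frob N N + 2 * frob N (fun p q => N q p).
  have -> : 2 * frob N N = frob N N + \sum_(i : pr16) N i.2 i.1 * N i.2 i.1.
    by rewrite -(sum_swap_pair (fun p q => N p q * N p q)) -/(frob N N); ring.
  rewrite /frob mulr_sumr -!big_split; apply: eq_bigr => i _ /=.
  by rewrite /M; ring.
have SM a : frob (clifR R a) M = 2 * frob (clifR R a) N.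
  rewrite (_ : 2 * _ = frob (clifR R a) N + frob (clifR R a) N); last by ring.
  rewrite {3}/frob (sum_swap_pair (fun p q => clifR R a p q * N p q)) -big_split.
  by apply: eq_bigr => i _; rewrite /M (clifR_sym _ a i.2) mulrDr.
have := bessel M (@frob_clif R); rewrite MM.
under [X in _ = _ - X *+ _]eq_bigr do rewrite SM exprMn.
rewrite -mulr_sumr => B.
have : 0 <= \sum_(i : pr16) (M i.1 i.2 *+ 16
    - \sum_c frob (clifR R c) M * clifR R c i.1 i.2) ^+ 2.
  by apply: sumr_ge0 => i _; exact: sqr_ge0.
have W0 : 0 <= \sum_c frob (clif2R R c) N ^+ 2.
  by apply: sumr_ge0 => i _; exact: sqr_ge0.
have T0 := sqr_ge0 (mtrace N).
rewrite B /block_form; move: W0 T0.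
move: (\sum_c frob (clif2R R c) N ^+ 2) (_ ^+ 2) (frob _ _) (frob _ _) (\sum_a _).
by move=> w t x y s; lra.
Qed.

Lemma dual_form_ge0 H : 0 <= dual_form H.
Proof.
rewrite /dual_form !addr_ge0 //.
- by rewrite mulr_ge0 ?sqr_ge0.
- by apply: sumr_ge0 => a _; exact: sqr_ge0.
- by rewrite mulr_ge0 // sumr_ge0 // => i _; rewrite -expr2 sqr_ge0.
- by apply: sumr_ge0 => i _; apply: sumr_ge0 => j _; exact: block_form_ge0.
Qed.

End DualForm.

(** * Values of the dual form at the Hessians of |z|^2 and of the coordinates of Q *)

Definition trace_check : bool := all (fun a =>
  foldr (fun p t => nth 0 (cell clif_tab p p) a + t) 0 (iota 0 16) == 0)
  (iota 0 9).

Lemma trace_checkT : trace_check. Proof. by vm_compute. Qed.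

Lemma mtrace_clif (A : comNzRingType) (a : 'I_9) : mtrace (clifR A a) = 0.
Proof.
have /allP/(_ _ (mem_iota0 a))/eqP := trace_checkT.
move/(congr1 (fun t : int => t%:~R : A)) => E; rewrite -[RHS]E clif_tabE.
rewrite /mtrace /clifR -rmorph_sum; congr _%:~R.
transitivity (\sum_(p < 16) nth 0 (cell (tabulate 9 clif) p p) a).
  apply: eq_bigr => p _; rewrite cell_tabulate (nth_map 0%N) ?size_iota //.
  by rewrite nth_iota.
rewrite -(big_mkord predT (fun p => nth 0 (cell (tabulate 9 clif) p p) a)).
rewrite /index_iota subn0; elim: (iota 0 16) => [|p s IH]; first by rewrite big_nil.
by rewrite big_cons IH.
Qed.

Section DualValues.
Context (R : realFieldType) (k : nat).
Implicit Types C : 'I_16 -> 'I_16 -> R.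

Lemma frob_clif2_sym C c : (forall p q, C p q = C q p) ->
  frob (clif2R R c) C = 0.
Proof.
move=> symC; have : frob (clif2R R c) C = - frob (clif2R R c) C.
  rewrite {1}/frob (sum_swap_pair (fun p q => clif2R R c p q * C p q)) -sumrN.
  by apply: eq_bigr => i _; rewrite clif2R_anti symC mulNr.
by move: (frob _ _) => x E; lra.
Qed.

(** For symmetric [C], the Hessian of \sum_i z_i^T C z_i. *)
Definition isotropic C (a b : 'I_k * 'I_16) : R :=
  (a.1 == b.1)%:R * (2 * C a.2 b.2).

(** The diagonal sum is 2k C, giving the part in k^2; the k diagonal blocks are 2 C and the others
    vanish, giving the part in k. The S_a S_b terms vanish by antisymmetry. *)
Lemma dual_form_isotropic C : (forall p q, C p q = C q p) ->
  dual_form (isotropic C) =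
  4 * (k%:R ^+ 2 * (5 * mtrace C ^+ 2 + (\sum_a frob (clifR R a) C ^+ 2)
       + 4 * frob C C)
  + k%:R * (16 * frob C C + 5 * mtrace C ^+ 2
            - \sum_a frob (clifR R a) C ^+ 2)).
Proof.
move=> symC.
have diagE p r : diag_sum (isotropic C) p r = k%:R * 2 * C p r.
  rewrite /diag_sum /isotropic /=; under eq_bigr do rewrite eqxx mul1r.
  by rewrite sumr_const card_ord -[(2 * _) *+ k]mulr_natl mulrA.
have trE (c : R) N : (forall p r, N p r = c * C p r) -> mtrace N = c * mtrace C.
  by move=> NE; rewrite /mtrace mulr_sumr; apply: eq_bigr => p _.
have frobE (c : R) E N : (forall p r, N p r = c * C p r) ->
    frob E N = c * frob E C.
  move=> NE; rewrite /frob mulr_sumr; apply: eq_bigr => x _.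
  by rewrite NE mulrCA.
have blockE i j : block_form (block (isotropic C) i j) = (i == j)%:R * (4 *
    (16 * frob C C + 5 * mtrace C ^+ 2 - \sum_a frob (clifR R a) C ^+ 2)).
  set N := block _ i j; pose e : R := (i == j)%:R * 2.
  have NE p r : N p r = e * C p r by rewrite /N /block /isotropic mulrA.
  have NE' p r : (fun p r => N r p) p r = e * C p r by rewrite NE symC.
  have e2 : e ^+ 2 = (i == j)%:R * 4.
    by rewrite /e exprMn; case: (i == j) => /=; rewrite ?expr1n ?expr0n /=; ring.
  rewrite /block_form (trE e) // !(frobE e _ N) // (frobE e _ _ NE').
  rewrite [frob N C]frobC (frobE e) //.
  under eq_bigr do rewrite (frobE e) // exprMn.
  under [X in _ + X]eq_bigr do rewrite (frobE e) // frob_clif2_sym // mulr0 expr0n /=.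
  rewrite [X in _ + X]big1 // -mulr_sumr exprMn.
  transitivity (e ^+ 2 * (16 * frob C C + 5 * mtrace C ^+ 2
    - \sum_a frob (clifR R a) C ^+ 2)); first by ring.
  by rewrite e2 mulrA.
rewrite /dual_form (trE _ _ diagE) (frobE _ _ _ diagE) frobC (frobE _ _ _ diagE).
under eq_bigr do rewrite (frobE _ _ _ diagE) exprMn.
rewrite -mulr_sumr [X in _ + X](_ : _ = k%:R * (4 *
    (16 * frob C C + 5 * mtrace C ^+ 2 - \sum_a frob (clifR R a) C ^+ 2))).
  by ring.
rewrite -[k in k%:R * _]card_ord mulr_natl -sumr_const; apply: eq_bigr => i _.
rewrite (bigD1 i) //= big1 => [|j ji]; rewrite blockE ?eqxx ?mul1r ?addr0 //.
by rewrite eq_sym (negbTE ji) mul0r.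
Qed.

Definition idmx (p q : 'I_16) : R := (p == q)%:R.

Lemma frob_idmx C : frob idmx C = mtrace C.
Proof. by rewrite mtraceE. Qed.

Lemma dual_form_idmx :
  dual_form (isotropic idmx) = 5376 * k%:R ^+ 2 + 6144 * k%:R.
Proof.
have tr1 : mtrace idmx = 16.
  by rewrite /mtrace; under eq_bigr do rewrite /idmx eqxx;
     rewrite sumr_const card_ord.
rewrite dual_form_isotropic => [|p q]; last by rewrite /idmx eq_sym.
rewrite frob_idmx tr1 big1 => [|a _]; first by ring.
by rewrite frobC frob_idmx mtrace_clif expr0n.
Qed.

(** The part linear in k vanishes as [block_form] is zero at S_b. With [dual_form_idmx] this fixes
    the constant: c = 9 * 1280 k^2 / (5376 k^2 + 6144 k) = 15k / (7k + 8). *)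
Lemma dual_form_clif b : dual_form (isotropic (clifR R b)) = 1280 * k%:R ^+ 2.
Proof.
rewrite dual_form_isotropic => [|p q]; last exact: clifR_sym.
rewrite mtrace_clif frob_clif eqxx (bigD1 b) //= big1 => [|a ab].
  by rewrite frob_clif eqxx !mulrb; ring.
by rewrite frob_clif (negbTE ab) mul0rn expr0n.
Qed.

End DualValues.

(** * Derivatives at the origin of polynomials and of their squares *)

(* Stated for abstract derivations, which keeps conversion from unfolding mderiv. *)
Lemma leibniz4 (A B : comNzRingType) (e : A -> B) (D1 D2 D3 D4 : A -> A) q :
  {morph e : x y / x + y} -> {morph e : x y / x * y} ->
  {morph D2 : x y / x + y} -> {morph D3 : x y / x + y} ->
  {morph D4 : x y / x + y} ->
  (forall x y, D1 (x * y) = D1 x * y + x * D1 y) ->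
  (forall x y, D2 (x * y) = D2 x * y + x * D2 y) ->
  (forall x y, D3 (x * y) = D3 x * y + x * D3 y) ->
  (forall x y, D4 (x * y) = D4 x * y + x * D4 y) ->
  e q = 0 -> e (D1 q) = 0 -> e (D2 q) = 0 -> e (D3 q) = 0 -> e (D4 q) = 0 ->
  e (D4 (D3 (D2 (D1 (q * q))))) =
  2 * (e (D2 (D1 q)) * e (D4 (D3 q)) + e (D3 (D1 q)) * e (D4 (D2 q))
       + e (D4 (D1 q)) * e (D3 (D2 q))).
Proof.
move=> eD eM D2D D3D D4D D1M D2M D3M D4M q0 q1 q2 q3 q4.
rewrite !(D1M, D2M, D3M, D4M, D2D, D3D, D4D, eD, eM) q0 q1 q2 q3 q4.
ring.
Qed.

Section LocalJets.
Context (R : realFieldType) (n k : nat) (h : 'I_k * 'I_16 -> 'I_n)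
  (h_inj : injective h).
Notation Ix := ('I_k * 'I_16)%type.
Implicit Types (p q : {mpoly R[n]}) (a b c d : Ix).

Definition at0 p : R := p.@[fun=> 0].
Definition grad0 p a : R := at0 p^`M(h a).
Definition hess0 p a b : R := at0 p^`M(h a)^`M(h b).
Definition jet4 p a b c d : R := at0 p^`M(h a)^`M(h b)^`M(h c)^`M(h d).
Definition dual_op p : R := quartic_op (jet4 p).

Definition flat0 p : Prop := at0 p = 0 /\ forall a, grad0 p a = 0.

Lemma at0D p q : at0 (p + q) = at0 p + at0 q. Proof. exact: mevalD. Qed.
Lemma at0M p q : at0 (p * q) = at0 p * at0 q. Proof. exact: mevalM. Qed.

Lemma hess0C p a b : hess0 p a b = hess0 p b a.
Proof. by rewrite /hess0 mderiv_comm. Qed.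

Lemma hess0_sq q a b :
  hess0 (q ^+ 2) a b = 2 * (grad0 q a * grad0 q b + at0 q * hess0 q a b).
Proof.
by rewrite expr2 /hess0 /grad0 !(mderivM, mderivD, at0D, at0M); ring.
Qed.

(** As q vanishes to order 2, each factor of q * q must receive exactly two of the four
    derivatives. *)
Lemma jet4_sq q : flat0 q -> jet4 (q ^+ 2) = fun a b c d =>
  2 * (hess0 q a b * hess0 q c d + hess0 q a c * hess0 q b d
       + hess0 q a d * hess0 q b c).
Proof.
case=> q0 g0; do 4!apply/funext => ?.
rewrite /jet4 expr2.
by apply: leibniz4 => //; try exact: g0; first [exact: at0D | exact: at0M
  | exact: mderivD | exact: mderivM].
Qed.

Lemma dual_op_sq q : flat0 q -> dual_op (q ^+ 2) = 2 * dual_form (hess0 q).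
Proof.
by move=> fq; rewrite /dual_op jet4_sq // quartic_op_square //; exact: hess0C.
Qed.

Lemma jet4D p q a b c d : jet4 (p + q) a b c d = jet4 p a b c d + jet4 q a b c d.
Proof. by rewrite /jet4 !mderivD at0D. Qed.

Lemma jet4Z (x : R) p a b c d : jet4 (x *: p) a b c d = x * jet4 p a b c d.
Proof. by rewrite /jet4 !mderivZ /at0 mevalZ. Qed.

Lemma dual_opD p q : dual_op (p + q) = dual_op p + dual_op q.
Proof.
rewrite /dual_op /quartic_op -big_split; apply: eq_bigr => i _ /=.
rewrite -big_split; apply: eq_bigr => j _ /=.
rewrite [RHS]addrACA [X in _ = X + _]addrACA -!mulrDr.
congr (_ * _ + _ + _ * _).
- by rewrite -big_split; apply: eq_bigr => u _ /=; rewrite -big_split;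
    apply: eq_bigr => v _; rewrite jet4D.
- rewrite -big_split; apply: eq_bigr => e _ /=.
  rewrite -big_split; apply: eq_bigr => u _ /=.
  by rewrite -big_split; apply: eq_bigr => v _; rewrite jet4D mulrDr.
- by rewrite -big_split; apply: eq_bigr => u _ /=; rewrite -big_split;
    apply: eq_bigr => v _; rewrite jet4D.
Qed.

Lemma dual_opZ (x : R) p : dual_op (x *: p) = x * dual_op p.
Proof.
rewrite /dual_op /quartic_op mulr_sumr; apply: eq_bigr => i _.
rewrite mulr_sumr; apply: eq_bigr => j _.
rewrite !mulrDr !(mulrCA x); congr (_ * _ + _ + _ * _).
- by rewrite mulr_sumr; apply: eq_bigr => u _; rewrite mulr_sumr;
    apply: eq_bigr => v _; rewrite jet4Z.
- rewrite mulr_sumr; apply: eq_bigr => e _; rewrite mulr_sumr.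
  apply: eq_bigr => u _; rewrite mulr_sumr; apply: eq_bigr => v _.
  by rewrite jet4Z mulrCA.
- by rewrite mulr_sumr; apply: eq_bigr => u _; rewrite mulr_sumr;
    apply: eq_bigr => v _; rewrite jet4Z.
Qed.

Lemma dual_op0 : dual_op 0 = 0.
Proof. by rewrite -(scale0r 0) dual_opZ mul0r. Qed.

Lemma hess0D p q a b : hess0 (p + q) a b = hess0 p a b + hess0 q a b.
Proof. by rewrite /hess0 !mderivD at0D. Qed.

Lemma at0Z (x : R) p : at0 (x *: p) = x * at0 p.
Proof. exact: mevalZ. Qed.

Lemma dual_op_sum (I : Type) (s : seq I) (F : I -> {mpoly R[n]}) :
  dual_op (\sum_(i <- s) F i) = \sum_(i <- s) dual_op (F i).
Proof. exact: (big_morph _ dual_opD dual_op0). Qed.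

Lemma grad0_sum (I : Type) (s : seq I) (F : I -> {mpoly R[n]}) a :
  grad0 (\sum_(i <- s) F i) a = \sum_(i <- s) grad0 (F i) a.
Proof.
rewrite (big_morph (grad0 ^~ a) (id1 := 0) (op1 := +%R)) // => [p q|].
  by rewrite /grad0 mderivD at0D.
by rewrite /grad0 mderiv0 /at0 meval0.
Qed.

Lemma hess0_sum (I : Type) (s : seq I) (F : I -> {mpoly R[n]}) a b :
  hess0 (\sum_(i <- s) F i) a b = \sum_(i <- s) hess0 (F i) a b.
Proof.
rewrite (big_morph (fun p => hess0 p a b) (id1 := 0) (op1 := +%R)) // => [p q|].
  exact: hess0D.
by rewrite /hess0 !mderiv0 /at0 meval0.
Qed.

(* The low order conditions on f force every q to vanish to order 2 at 0, so that
   the fourth derivatives of q^2 only involve the Hessian of q. *)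
Lemma dual_op_sos_ge0 (s : seq {mpoly R[n]}) (f : {mpoly R[n]}) :
  f = \sum_(q <- s) q ^+ 2 -> at0 f = 0 -> (forall a, hess0 f a a = 0) ->
  0 <= dual_op f.
Proof.
move=> fE f0 h0.
have sq0 q : q \in s -> at0 q = 0.
  have : \sum_(q <- s) at0 q ^+ 2 = 0.
    rewrite -[RHS]f0 fE /at0 raddf_sum.
    by apply: eq_bigr => p _; rewrite /= expr2 -mevalM -expr2.
  move/eqP; rewrite psumr_eq0 => [|p _]; last exact: sqr_ge0.
  by move=> /allP s0 /s0 /=; rewrite sqrf_eq0 => /eqP.
have sg0 q : q \in s -> forall a, grad0 q a = 0.
  move=> qs a; have : \sum_(q <- s) hess0 (q ^+ 2) a a = 0.
    by rewrite -hess0_sum -fE.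
  rewrite (eq_big_seq (fun q => 2 * grad0 q a ^+ 2)); last first.
    by move=> p ps; rewrite hess0_sq sq0 // mul0r addr0.
  move/eqP; rewrite psumr_eq0 => [|p _]; last by rewrite mulr_ge0 ?sqr_ge0.
  by move=> /allP/(_ q qs) /=; rewrite mulf_eq0 pnatr_eq0 sqrf_eq0 => /eqP.
rewrite fE dual_op_sum big_seq; apply: sumr_ge0 => q qs.
by rewrite dual_op_sq ?mulr_ge0 ?dual_form_ge0 //; split; auto.
Qed.

Definition coords i r : {mpoly R[n]} := 'X_(h (i, r)).

Definition quadf (C : 'I_16 -> 'I_16 -> int) : {mpoly R[n]} :=
  \sum_i \sum_(x : pr16) (C x.1 x.2)%:~R * (coords i x.1 * coords i x.2).

Lemma grad0Z (x : R) p a : grad0 (x *: p) a = x * grad0 p a.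
Proof. by rewrite /grad0 mderivZ /at0 mevalZ. Qed.

Lemma hess0Z (x : R) p a b : hess0 (x *: p) a b = x * hess0 p a b.
Proof. by rewrite /hess0 !mderivZ /at0 mevalZ. Qed.

Lemma intr_mulE (m : int) p : m%:~R * p = (m%:~R : R) *: p.
Proof. by rewrite mulrzl scaler_int. Qed.

Lemma mderiv_var (u v : 'I_n) : 'X_u^`M(v) = (u == v)%:R :> {mpoly R[n]}.
Proof.
rewrite mderivX mnm1E; case: eqVneq => [->|_]; last by rewrite scale0r.
by rewrite scale1r -{1}[U_(v)%MM]add0m addmK mpolyX0.
Qed.

Lemma at0_coords i r : at0 (coords i r) = 0.
Proof. by rewrite /at0 mevalXU. Qed.

Lemma at0_nat (m : nat) : at0 m%:R = m%:R.
Proof. by rewrite /at0 rmorph_nat. Qed.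

Lemma grad0_coords i r a : grad0 (coords i r) a = ((i, r) == a)%:R.
Proof. by rewrite /grad0 mderiv_var at0_nat (inj_eq h_inj). Qed.

Lemma flat0_quadf C : flat0 (quadf C).
Proof.
split=> [|a].
  rewrite /quadf /at0 raddf_sum big1 // => i _; rewrite raddf_sum big1 // => x _.
  by rewrite /= !mevalM -!/(at0 _) at0_coords mul0r mulr0.
rewrite /quadf grad0_sum big1 // => i _; rewrite grad0_sum big1 // => x _.
rewrite intr_mulE grad0Z /grad0.
by rewrite mderivM at0D !at0M !at0_coords mulr0 mul0r addr0 mulr0.
Qed.

Lemma hess0_quadf C : (forall r u, C r u = C u r) ->
  hess0 (quadf C) = isotropic (fun r u => (C r u)%:~R).
Proof.
move=> symC; apply/funext => -[j r]; apply/funext => -[l u].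
rewrite /quadf hess0_sum /isotropic /=.
have termE i (x : pr16) :
    hess0 ((C x.1 x.2)%:~R * (coords i x.1 * coords i x.2)) (j, r) (l, u)
  = (i == j)%:R * ((i == l)%:R * ((C x.1 x.2)%:~R * (x == (r, u))%:R
     + (C x.1 x.2)%:~R * (x == (u, r))%:R)) :> R.
  rewrite intr_mulE hess0Z /hess0 !(mderivM, mderivD, at0D, at0M).
  rewrite !at0_coords -!/(grad0 _ _) !grad0_coords.
  case: x => v w /=; rewrite !xpair_eqE.
  by rewrite -!mulnb !natrM; ring.
rewrite (bigD1 j) //= [X in _ + X]big1 ?addr0 => [|i ij]; last first.
  rewrite hess0_sum big1 // => x _.
  by rewrite termE (negbTE ij) mul0r.
rewrite hess0_sum; under eq_bigr do rewrite termE eqxx mul1r.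
rewrite -mulr_sumr big_split /=; congr (_ * _).
have sum1 (v : pr16) : \sum_(x : pr16) (C x.1 x.2)%:~R * (x == v)%:R =
    (C v.1 v.2)%:~R :> R.
  rewrite (bigD1 v) //= eqxx mulr1 big1 ?addr0 // => x /negbTE ->.
  by rewrite mulr0.
by rewrite !sum1 /= (symC u r); ring.
Qed.

End LocalJets.

(** * The octonionic form expressed through the Clifford system *)

Definition lo8 (b : 'I_8) : 'I_16 := @lshift 8 8 b.
Definition hi8 (b : 'I_8) : 'I_16 := @rshift 8 8 b.

Section Octonions.
Context (A : comNzRingType) (k : nat).
Implicit Types x y : 'M[A]_(k, 8).

Definition stack x y (i : 'I_k) (p : 'I_16) : A :=
  match split (p : 'I_(8 + 8)) with inl b => x i b | inr b => y i b end.

Lemma sum16 (F : 'I_16 -> A) :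
  \sum_p F p = \sum_(b < 8) F (lo8 b) + \sum_(b < 8) F (hi8 b).
Proof. exact: (@big_split_ord _ _ _ 8 8). Qed.

Lemma stackl x y i b : stack x y i (lo8 b) = x i b.
Proof. by rewrite /stack (unsplitK (inl b)). Qed.

Lemma stackr x y i b : stack x y i (hi8 b) = y i b.
Proof. by rewrite /stack (unsplitK (inr b)). Qed.

Lemma onormsq_row x i : onormsq (row i x) = \sum_b x i b ^+ 2.
Proof. by apply: eq_bigr => b _; rewrite mxE. Qed.

Lemma vip_stack x y :
  vip (stack x y) (stack x y) = ovnormsq x + ovnormsq y.
Proof.
rewrite /vip /ovnormsq -big_split; apply: eq_bigr => i _ /=.
rewrite /ip sum16 !onormsq_row; congr (_ + _); apply: eq_bigr => b _.
  by rewrite stackl.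
by rewrite stackr.
Qed.

Lemma bilE a (z w : 'I_16 -> A) :
  bil a z w = \sum_p \sum_q (z p * w q) *~ clif a p q.
Proof. by rewrite pair_bigA; apply: eq_bigr => x _; rewrite mulrzl. Qed.

Lemma vbil_stack_max x y :
  vbil ord_max (stack x y) (stack x y) = ovnormsq x - ovnormsq y.
Proof.
rewrite /vbil /ovnormsq -sumrB; apply: eq_bigr => i _; rewrite bilE.
have -> : \sum_p \sum_q (stack x y i p * stack x y i q) *~ clif 8 p q =
    \sum_p stack x y i p ^+ 2 *~ (if (p < 8)%N then 1 else -1).
  apply: eq_bigr => p _; rewrite (bigD1 p) //= /clif /= eqxx big1 ?addr0 // => q.
  by rewrite -val_eqE eq_sym /= => /negbTE ->.
rewrite sum16 !onormsq_row -sumrN; congr (_ + _); apply: eq_bigr => b _.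
  by rewrite stackl /= ltn_ord.
by rewrite stackr /= mulrNz.
Qed.

(** Each of the two off-diagonal blocks of S_l contributes one copy of the coordinate of (x, y). *)
Lemma vbil_stack x y (l : 'I_8) :
  vbil (widen_ord (leqnSn 8) l) (stack x y) (stack x y) = ovdot x y 0 l *+ 2.
Proof.
rewrite /vbil /ovdot summxE -sumrMnl; apply: eq_bigr => i _; rewrite bilE.
(* The structure constants of conj(e_b) e_d. *)
pose c (b d : 'I_8) : int := if b == 0%N :> nat then oct_coef b d l else - oct_coef b d l.
have l8 : (l == 8 :> nat) = false by rewrite ltn_eqF.
have -> : omul (oconj (row i x)) (row i y) 0 l =
    \sum_(b < 8) \sum_(d < 8) (x i b * y i d) *~ c b d.
  rewrite mxE; apply: eq_bigr => b _; apply: eq_bigr => d _; rewrite !mxE /c.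
  by rewrite -val_eqE /=; case: eqP => _ //; rewrite mulNr mulrNz mulNrz.
rewrite sum16 mulr2n; congr (_ + _).
  apply: eq_bigr => b _; rewrite sum16 big1 ?add0r => [|d _]; last first.
    by rewrite /clif /= l8 !ltn_ord mulr0z.
  apply: eq_bigr => d _; rewrite stackl stackr /clif /= l8 ltn_ord.
  by rewrite addKn.
rewrite [RHS]exchange_big /=.
transitivity (\sum_(d < 8) \sum_(b < 8)
    (stack x y i (hi8 d) * stack x y i (lo8 b)) *~ clif l (hi8 d) (lo8 b)).
  apply: eq_bigr => d _; rewrite sum16 [X in _ + X]big1 ?addr0 // => b _.
  by rewrite /clif /= l8 mulr0z.
apply: eq_bigr => d _; apply: eq_bigr => b _.
rewrite stackl stackr /clif /= l8 ltn_ord addKn.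
by rewrite [y _ _ * _]mulrC.
Qed.

(** Polarization: (|x|^2 + |y|^2)^2 - (|x|^2 - |y|^2)^2 = 4 |x|^2 |y|^2, while the eight other
    coordinates of Q contribute 4 |(x, y)|^2. *)
Lemma cs_oct_clif x y : cs_oct x y *+ 4 =
  vip (stack x y) (stack x y) ^+ 2
  - \sum_a vbil a (stack x y) (stack x y) ^+ 2.
Proof.
rewrite vip_stack big_ord_recr /= vbil_stack_max.
under eq_bigr do rewrite vbil_stack -mulr_natr exprMn.
by rewrite -mulr_suml -/(onormsq (ovdot x y)) /cs_oct; ring.
Qed.

End Octonions.

(** * Matching the 16k polynomial variables with k vectors of R^16 *)

Section Coordinates.
Context (R : realType) (k : nat).

Definition zidx (a : 'I_k * 'I_16) : 'I_(16 * k) :=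
  match split (a.2 : 'I_(8 + 8)) with
  | inl b => xcoord a.1 b | inr b => ycoord a.1 b end.

Lemma zidx_inj : injective zidx.
Proof.
have vec_inj : injective (fun ib : 'I_k * 'I_8 => mxvec_index ib.1 ib.2).
  by move=> [i b] [j d] /cast_ord_inj/enum_rank_inj.
move=> [i p] [j q]; rewrite /zidx /xcoord /ycoord /=.
rewrite -[in (i, p)](splitK (p : 'I_(8 + 8))) -[in (j, q)](splitK (q : 'I_(8 + 8))).
case: (split _) => b; case: (split _) => d /cast_ord_inj/eqP.
- by rewrite eq_lshift => /eqP e; have [-> ->] := vec_inj (i, b) (j, d) e.
- by rewrite eq_lrshift.
- by rewrite eq_rlshift.
- by rewrite eq_rshift => /eqP e; have [-> ->] := vec_inj (i, b) (j, d) e.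
Qed.

Lemma zidx_bij : bijective zidx.
Proof.
apply: inj_card_bij zidx_inj _.
by rewrite card_prod !card_ord mulnC.
Qed.

Lemma sum_zidx (V : nmodType) (F : 'I_(16 * k) -> V) :
  \sum_j F j = \sum_i \sum_p F (zidx (i, p)).
Proof.
rewrite pair_bigA (reindex zidx); last exact: onW_bij zidx_bij.
by apply: eq_bigr => -[i p].
Qed.

Notation Zvar := (coords R zidx).

Lemma stack_vars : stack (xvars R k) (yvars R k) = Zvar.
Proof.
apply/funext => i; apply/funext => p; rewrite /stack /coords /zidx.
by case: (split _) => b; rewrite mxE.
Qed.

Lemma vip_vars : vip Zvar Zvar = normsq_poly R (16 * k).
Proof. by rewrite /normsq_poly sum_zidx. Qed.

Lemma ovnormsq_vars :
  ovnormsq (xvars R k) + ovnormsq (yvars R k) = normsq_poly R (16 * k).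
Proof. by rewrite -vip_stack stack_vars vip_vars. Qed.

Lemma csO_clif : csO R k *+ 4 =
  vip Zvar Zvar ^+ 2 - \sum_a vbil a Zvar Zvar ^+ 2.
Proof. by rewrite cs_oct_clif stack_vars. Qed.

Definition point_coords (z : 'rV[R]_(16 * k)) i p : R := z 0 (zidx (i, p)).

Lemma point_of_coords (Z : 'I_k -> 'I_16 -> R) : exists z, point_coords z = Z.
Proof.
have [g gK _] := zidx_bij; exists (\row_j Z (g j).1 (g j).2).
by apply/funext => i; apply/funext => p; rewrite /point_coords mxE gK.
Qed.

Lemma unit_sphereE z : unit_sphere z <-> vip (point_coords z) (point_coords z) = 1.
Proof. by rewrite /unit_sphere /= sum_zidx. Qed.

Lemma peval_normsq z : peval (normsq_poly R (16 * k)) z =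
  vip (point_coords z) (point_coords z).
Proof.
rewrite /peval /normsq_poly raddf_sum sum_zidx; apply: eq_bigr => i _.
by apply: eq_bigr => p _; rewrite /= rmorphXn /= mevalXU.
Qed.

Lemma peval_csO_cquartic z : peval (csO R k) z = cquartic 1 (point_coords z) / 4.
Proof.
rewrite peval_csO; set x := (X in cs_oct X _); set y := (X in cs_oct _ X).
have := cs_oct_clif x y; have -> : stack x y = point_coords z.
  apply/funext => i; apply/funext => p; rewrite /stack /point_coords /zidx.
  by case: (split _) => b; rewrite mxE.
by rewrite /cquartic mul1r => <-; field.
Qed.

End Coordinates.

(** * Closure properties of sums of squares; attained extrema *)

Section SumsOfSquares.
Context (R : realType) (n : nat).
Implicit Types p q : {mpoly R[n]}.

Lemma sos_sqr q : is_sos (q ^+ 2).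
Proof. by exists [:: q]; rewrite big_seq1. Qed.

Lemma sosD p q : is_sos p -> is_sos q -> is_sos (p + q).
Proof. by case=> s -> [t ->]; exists (s ++ t); rewrite big_cat. Qed.

Lemma sos_sum (I : finType) (F : I -> {mpoly R[n]}) :
  (forall i, is_sos (F i)) -> is_sos (\sum_i F i).
Proof.
by move=> sF; elim/big_ind: _ => //; [exists [::]; rewrite big_nil | exact: sosD].
Qed.

Lemma sosZ (x : R) p : 0 <= x -> is_sos p -> is_sos (x *: p).
Proof.
move=> x0 [s ->]; exists [seq Num.sqrt x *: q | q <- s].
rewrite big_map scaler_sumr; apply: eq_bigr => q _.
by rewrite exprZn sqr_sqrtr.
Qed.

Lemma sos_natl m p : is_sos p -> is_sos (m%:R * p).
Proof.
by move=> sp; rewrite mulr_natl -scaler_nat; apply: sosZ.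
Qed.

End SumsOfSquares.

Lemma set_maxE (R : realType) (S : set R) m :
  S m -> (forall a, S a -> a <= m) -> set_max S = m.
Proof.
move=> Sm ub; apply: xget_unique => // m' [Sm' ub'].
by apply/eqP; rewrite eq_le ub // ub'.
Qed.

Lemma set_minE (R : realType) (S : set R) m :
  S m -> (forall a, S a -> m <= a) -> set_min S = m.
Proof.
move=> Sm lb; apply: xget_unique => // m' [Sm' lb'].
by apply/eqP; rewrite eq_le lb // lb'.
Qed.

(** * Maximum, minimum and exact sum of squares bound of the Cauchy-Schwarz form *)

Section Gap.
Context (R : realType) (k : nat) (hk : (17 <= k)%N).

Notation Zvar := (coords R (@zidx k)).
Notation nsq := (normsq_poly R (16 * k)).

(* (1 - c) / 4 for c = 15k / (7k + 8). *)
Definition sos_threshold : R := 1 / 4 - 15 * k%:R / (4 * (7 * k%:R + 8)).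

Lemma natk_ge17 : 17 <= k%:R :> R.
Proof. by rewrite (ler_nat R 17). Qed.

Lemma csO_max : pmax (csO R k) = 1 / 4.
Proof.
apply: set_maxE => [|_ [z /unit_sphereE z1 <-]]; last first.
  rewrite peval_csO_cquartic /cquartic z1 expr1n mul1r ler_pM2r ?invr_gt0 //.
  by rewrite gerBl sumr_ge0 // => a _; exact: sqr_ge0.
(* The first 16 vectors form a scaled orthonormal basis and the rest vanish, so \sum_i z_i z_i^T is
   the identity over 16 and each coordinate of Q is tr(S_a) / 16 = 0. *)
pose Z (i : 'I_k) (p : 'I_16) : R := (i == p :> nat)%:R / 4.
have ZZ (p q : 'I_16) : \sum_i Z i p * Z i q = (p == q)%:R / 16.
  have pk : (p < k)%N by rewrite (leq_trans (ltn_ord p)) // ltnW.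
  rewrite (bigD1 (Ordinal pk)) //= big1 ?addr0 => [|i].
    by rewrite /Z /= eqxx val_eqE; case: (p == q); rewrite !mulrb; field.
  by rewrite /Z -val_eqE /= => /negbTE ->; rewrite !mul0r.
have [z zZ] := point_of_coords Z.
exists z.
  apply/unit_sphereE; rewrite zZ /vip exchange_big /=.
  under eq_bigr do rewrite ZZ eqxx.
  by rewrite sumr_const card_ord !mulrb; field.
rewrite peval_csO_cquartic zZ /cquartic.
have -> : vip Z Z = 1.
  rewrite /vip exchange_big /=; under eq_bigr do rewrite ZZ eqxx.
  by rewrite sumr_const card_ord !mulrb; field.
rewrite big1 => [|a _]; first by field.
rewrite /vbil exchange_big /=.
under eq_bigr do rewrite -mulr_sumr ZZ.
have -> : \sum_(x : pr16) clifR R a x.1 x.2 * ((x.1 == x.2)%:R / 16) =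
    mtrace (clifR R a) / 16.
  by rewrite mtraceE mulr_suml; apply: eq_bigr => x _; rewrite mulrA [X in X / _]mulrC.
by rewrite mtrace_clif mul0r expr0n.
Qed.

Lemma csO_min : pmin (csO R k) = 0.
Proof.
apply: set_minE => [|_ [z _ <-]]; last first.
  rewrite peval_csO_cquartic divr_ge0 // /cquartic mul1r subr_ge0.
  exact: vbil_diag_le.
have k0 : (0 < k)%N by exact: leq_trans hk.
pose i0 : 'I_k := Ordinal k0.
(* With a single nonzero vector, [bil_diag_norm] turns |Q| <= |z|^2 into an equality. *)
pose Z (i : 'I_k) (p : 'I_16) : R := ((i == i0) && (p == 0))%:R.
have Z0 i : i != i0 -> forall p, Z i p = 0.
  by move=> /negbTE ii p; rewrite /Z ii.
have vipZ : vip Z Z = ip (Z i0) (Z i0).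
  rewrite /vip (bigD1 i0) //= big1 ?addr0 // => i ii.
  by rewrite /ip big1 // => p _; rewrite Z0 // mul0r.
have vbilZ a : vbil a Z Z = bil a (Z i0) (Z i0).
  rewrite /vbil (bigD1 i0) //= big1 ?addr0 // => i ii.
  by rewrite /bil /frob big1 // => x _; rewrite /outer Z0 // mul0r mulr0.
have [z zZ] := point_of_coords Z; exists z.
  apply/unit_sphereE; rewrite zZ vipZ /ip (bigD1 0) //= big1 => [|p /negbTE p0].
    by rewrite /Z !eqxx mulr1 addr0.
  by rewrite /Z p0 andbF mul0r.
rewrite peval_csO_cquartic zZ /cquartic vipZ.
under eq_bigr do rewrite vbilZ.
by rewrite bil_diag_norm mul1r subrr mul0r.
Qed.

Lemma csO_shift (g : R) : csO R k - g *: nsq ^+ 2 =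
  (1 / 4 - g) *: vip Zvar Zvar ^+ 2 - (1 / 4) *: \sum_a vbil a Zvar Zvar ^+ 2.
Proof.
have -> : csO R k = (1 / 4) *: (csO R k *+ 4).
  by rewrite -scaler_nat scalerA (_ : 1 / 4 * 4%:R = 1) ?scale1r //; field.
by rewrite csO_clif scalerBr scalerBl vip_vars addrAC.
Qed.

Lemma csO_threshold_sos : is_sos (csO R k - sos_threshold *: nsq ^+ 2).
Proof.
have k17 := natk_ge17.
(* Undoes the factor 4 of [csO_clif] and the factors [64 * k%:R] and [7 * k%:R + 8] of the
   certificate. *)
pose c : R := (256 * k%:R * (7 * k%:R + 8))^-1.
have c0 : 0 <= c by rewrite invr_ge0 !mulr_ge0 ?addr_ge0 ?mulr_ge0.
have -> : csO R k - sos_threshold *: nsq ^+ 2 = c *: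
    ((vip Zvar Zvar ^+ 2 * (15 * k%:R)
      - (\sum_a vbil a Zvar Zvar ^+ 2) * (7 * k%:R + 8)) * (64 * k%:R)).
  rewrite csO_shift.
  move: (vip _ _ ^+ 2) (\sum_a _) => N Q.
  rewrite (_ : (N * (15 * k%:R) - Q * (7 * k%:R + 8)) * (64 * k%:R) =
    (15 * k%:R * (64 * k%:R)) *: N - ((7 * k%:R + 8) * (64 * k%:R)) *: Q); last first.
    by rewrite -!mul_mpolyC !(mpolyCM, mpolyCD, mpolyC_nat); ring.
  rewrite scalerBr !scalerA /c /sos_threshold; congr (_ *: _ - _ *: _).
    by field; rewrite !lt0r_neq0 //; lra.
  by field; rewrite !lt0r_neq0 //; lra.
rewrite gap_certificate.
apply: sosZ => //; apply: sosD.
  apply: sos_natl.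
  by do 3!(apply: sos_sum => ?); exact: sos_sqr.
rewrite expr2 -!mulrA; do 3!apply: sos_natl.
by do 3!(apply: sos_sum => ?); exact: sos_sqr.
Qed.

Lemma vip_quadf : vip Zvar Zvar = quadf R (@zidx k) (fun p q => (p == q)%:R).
Proof.
apply: eq_bigr => i _; rewrite -mtrace_outer mtraceE.
by apply: eq_bigr => x _; rewrite mulrz_nat.
Qed.

Lemma vbil_quadf (a : 'I_9) :
  vbil a Zvar Zvar = quadf R (@zidx k) (fun p q => clif a p q).
Proof. by []. Qed.

(** The dual operator is nonnegative on the assumed sum of squares, and its value there is affine in
    [g], with zero at the threshold. *)
Lemma threshold_ub (g : R) :
  is_sos (csO R k - g *: nsq ^+ 2) -> g <= sos_threshold.
Proof.
have k17 := natk_ge17; have inj := @zidx_inj k.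
case=> s; rewrite csO_shift -scaleNr => fE.
have flatN : flat0 (@zidx k) (vip Zvar Zvar).
  by rewrite vip_quadf; exact: flat0_quadf.
have flatQ a : flat0 (@zidx k) (vbil a Zvar Zvar) by rewrite vbil_quadf; exact: flat0_quadf.
have hessN : hess0 (@zidx k) (vip Zvar Zvar) = isotropic (@idmx R).
  rewrite vip_quadf hess0_quadf // => [|p q]; last by rewrite eq_sym.
  by congr isotropic; apply/funext => p; apply/funext => q; rewrite mulrz_nat.
have hessQ a : hess0 (@zidx k) (vbil a Zvar Zvar) = isotropic (clifR R a).
  by rewrite vbil_quadf hess0_quadf // => p q; rewrite clif_sym.
have sq0 q : flat0 (@zidx k) q -> at0 (q ^+ 2) = 0.
  by case=> q0 _; rewrite expr2 at0M q0 mul0r.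
have sqh q a : flat0 (@zidx k) q -> hess0 (@zidx k) (q ^+ 2) a a = 0.
  by case=> q0 g0; rewrite hess0_sq q0 g0; ring.
have : 0 <= dual_op (@zidx k) ((1 / 4 - g) *: vip Zvar Zvar ^+ 2
    + - (1 / 4) *: \sum_a vbil a Zvar Zvar ^+ 2).
  apply: dual_op_sos_ge0 fE _ _ => [|a].
    rewrite at0D !at0Z sq0 // /at0 raddf_sum big1 => [|a _]; last exact: sq0.
    by rewrite !mulr0 addr0.
  rewrite hess0D !hess0Z sqh // hess0_sum big1 => [|b _]; last exact: sqh.
  by rewrite !mulr0 addr0.
rewrite dual_opD !dual_opZ dual_op_sum dual_op_sq // hessN dual_form_idmx.
under eq_bigr do rewrite dual_op_sq // hessQ dual_form_clif.
rewrite sumr_const card_ord -[_ *+ 9]mulr_natr /sos_threshold.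
move: k17; move: (k%:R : R) => K K17 h.
(* Here 5760 = 9 * 2 * 1280 / 4: nine coordinates of Q, the factor 2 of [dual_op_sq], and the weight
   1/4. *)
have {h} h : 0 <= K * ((1 / 4 - g) * (2 * (5376 * K + 6144)) - 5760 * K) by lra.
rewrite pmulr_rge0 in h; last by lra.
rewrite lerBrDr -lerBrDl ler_pdivrMr; last by lra.
lra.
Qed.

Lemma natk_pos_denom : 0 < 4 * (7 * k%:R + 8) :> R.
Proof. have := natk_ge17; lra. Qed.

Lemma csO_sos_min : pmin_sos 2 (csO R k) = sos_threshold.
Proof. exact: set_maxE csO_threshold_sos threshold_ub. Qed.

(** Equivalent to c > 2, that is 15k > 14k + 16. *)
Lemma sos_threshold_lt : sos_threshold < - (1 / 4).
Proof.
have k17 := natk_ge17; rewrite /sos_threshold ltrBlDr -ltrBlDl.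
rewrite ltr_pdivlMr ?natk_pos_denom //; lra.
Qed.

End Gap.

(** * Convexity and homogeneity of the shifted form *)

Section Convexity.
Context (R : realType) (k : nat).

Let p : {mpoly R[16 * k]} :=
  csO R k + (1 / 4) *: (ovnormsq (xvars R k) + ovnormsq (yvars R k)) ^+ 2.

Lemma peval_shifted z : peval p z = cquartic 2 (point_coords z) / 4.
Proof.
rewrite /p ovnormsq_vars /peval mevalD mevalZ rmorphXn /=.
rewrite -!/(peval _ _) peval_csO_cquartic peval_normsq /cquartic.
by field.
Qed.

Lemma shifted_convex : convex_poly p.
Proof.
move=> t x y _ _; rewrite !peval_shifted.
set X := point_coords x; set Y := point_coords y.
have -> : point_coords (conv t x y) = comb t%:num (1 - t%:num) X Y.
  by apply/funext => i; apply/funext => q; rewrite /point_coords !mxE.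
have cvx := @cquartic_convex R k t%:num (1 - t%:num) X Y (ge0 t).
rewrite ler_pdivrMr // [leRHS](_ : _ =
  (t%:num * (cquartic 2 X / 4) + (1 - t%:num) * (cquartic 2 Y / 4)) * 4) //.
rewrite [leRHS](_ : _ = t%:num * cquartic 2 X + (1 - t%:num) * cquartic 2 Y); last by field.
by apply: cvx; [rewrite subr_ge0; exact: le1 | ring].
Qed.

Lemma quadf_homog (C : 'I_16 -> 'I_16 -> int) : quadf R (@zidx k) C \is 2.-homog.
Proof.
apply: rpred_sum => i _; apply: rpred_sum => x _.
rewrite intr_mulE; apply: dhomogZ.
by apply: (@dhomogM _ _ _ 1 _ 1); rewrite dhomogX /= mdeg1.
Qed.

Lemma shifted_homog : p \is 4.-homog.
Proof.
(* The shift by -1/4 writes [p] as a combination of squares of quadratic forms. *)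
have := csO_shift k (- (1 / 4) : R).
rewrite scaleNr opprK -ovnormsq_vars -/p => ->.
apply: rpredB; apply: dhomogZ.
  by rewrite vip_quadf; apply: (dhomogMn (d := 2)); exact: quadf_homog.
apply: rpred_sum => a _; rewrite vbil_quadf.
by apply: (dhomogMn (d := 2)); exact: quadf_homog.
Qed.

End Convexity.

Theorem theorem1p2 (R : realType) (k : nat) (hk : (17 <= k)%N) :
  2 < gap 2 (csO R k) /\
  let p : {mpoly R[16 * k]} :=
    csO R k + (1 / 4) *: (ovnormsq (xvars R k) + ovnormsq (yvars R k)) ^+ 2 in
  [/\ p \is 4.-homog, convex_poly p & ~ is_sos p].
Proof.
have lt_threshold := sos_threshold_lt R hk.
split.
  (* With maximum 1/4 and minimum 0 the gap is 1 - 4 [sos_threshold], which is c. *)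
  rewrite /gap csO_max // csO_min // csO_sos_min // subr0 ltr_pdivlMr; lra.
split; [exact: shifted_homog | exact: shifted_convex |].
rewrite ovnormsq_vars => psos.
(* If [p] were a sum of squares, -1/4 would be an admissible bound, but it lies above the largest
   one. *)
have /(threshold_ub hk) : is_sos (csO R k - (- (1 / 4)) *: normsq_poly R (16 * k) ^+ 2).
  by rewrite scaleNr opprK.
by rewrite leNgt lt_threshold.
Qed.
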